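(* Let $\gamma > 0$ and $\delta > 0$, and let $0 \leq v \in L^\infty(\mathbb{R}^2)$ be a potential such that $v(x,y) \geq \gamma$ for all $(x,y)\in\mathbb{R}^2$ with $-\delta < x < \delta$, and $v(x,y) = 0$ for all other $(x,y) \in \mathbb{R}^2$. Then $$\lim_{L \to \infty} L^2\, \Gamma_v(L) = 0.$$
   Context: The dimension is $d=2$. For $L>0$ let $\Lambda_L = \left(-\frac{L}{2}, \frac{L}{2}\right)^2 \subset \mathbb{R}^2$. For a non-negative $v \in L^\infty(\mathbb{R}^2)$, let $h_L = -\Delta + v$ be the self-adjoint Schrödinger operator in $L^2(\Lambda_L)$ with Dirichlet boundary conditions on $\partial\Lambda_L$, with domain $H^1_0(\Lambda_L)\cap H^2(\Lambda_L)$. It has purely discrete spectrum; its eigenvalues, counted with multiplicity, are denoted $\lambda_0(L) < \lambda_1(L) \leq \dots$. The spectral gap is $\Gamma_v(L) := \lambda_1(L) - \lambda_0(L)$. *)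

(* Defs.v *)
From HB Require Import structures.
From mathcomp Require Import all_boot all_order all_algebra.
From mathcomp Require Import all_classical all_reals all_analysis.

Set Implicit Arguments.
Unset Strict Implicit.
Unset Printing Implicit Defensive.

Import Order.TTheory GRing.Theory Num.Theory.
Import numFieldNormedType.Exports.

Local Open Scope classical_set_scope.
Local Open Scope ring_scope.

(* [plane R] carries the product sigma-algebra, while the topological and
   normed structures used below to differentiate are those of [R * R]; the two
   types are convertible.  Function spaces consist of real-valued functions,
   equality in L^2 being equality almost everywhere. *)
Notation plane R := (measurableTypeR R * measurableTypeR R)%type.

Section Definitions.
Context {R : realType}.
Implicit Types (Omega : set (plane R)) (f g u v w phi : plane R -> R).

Definition lebesgue2 : {measure set (plane R) -> \bar R} :=
  (@lebesgue_measure R \x @lebesgue_measure R)%E.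

Definition square (L : R) : set (plane R) :=
  `](- (L / 2)), (L / 2)[ `*` `](- (L / 2)), (L / 2)[.

Definition Linfty_plane v : Prop := v \in Lfun lebesgue2 +oo%E.

Definition L2 Omega f : Prop := f \_ Omega \in Lfun lebesgue2 2%:E.

Definition norm2 Omega f : \bar R :=
  'N[lebesgue2]_(2%:E)[EFin \o (f \_ Omega)].

Definition inner Omega f g : R := \int[lebesgue2]_(z in Omega) (f z * g z).

Definition axis (i : 'I_2) : R * R := if i == ord0 then (1, 0) else (0, 1).

Definition partial (i : 'I_2) (phi : R * R -> R) : R * R -> R :=
  fun z => 'D_(axis i) phi z.

Definition iter_partial (s : seq 'I_2) (phi : R * R -> R) : R * R -> R :=
  foldr partial phi s.

Definition smooth (phi : R * R -> R) : Prop :=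
  forall s : seq 'I_2, continuous (iter_partial s phi) /\
    forall (i : 'I_2) (z : R * R), derivable (iter_partial s phi) z (axis i).

Definition test_function (Omega : set (R * R)) (phi : R * R -> R) : Prop :=
  let supp := closure [set z | phi z != 0] in
  [/\ smooth phi, compact supp & supp `<=` Omega].

Definition weak_partial Omega (i : 'I_2) f g : Prop :=
  [/\ L2 Omega f, L2 Omega g &
    forall phi, test_function Omega phi ->
      inner Omega f (partial i phi) = - inner Omega g phi].

Definition H1 Omega f : Prop :=
  L2 Omega f /\ forall i, exists g, weak_partial Omega i f g.

Definition H2 Omega f : Prop :=
  L2 Omega f /\ forall i, exists2 g, weak_partial Omega i f g & H1 Omega g.

(* The closure of the test functions in the norm of H^1. *)
Definition H10 Omega f : Prop :=
  L2 Omega f /\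
  exists2 g : 'I_2 -> plane R -> R,
    forall i, weak_partial Omega i f (g i) &
    forall e : R, 0 < e -> exists2 phi, test_function Omega phi &
      (norm2 Omega (f \- phi)%R < e%:E)%E /\
      forall i, (norm2 Omega (g i \- partial i phi)%R < e%:E)%E.

(* The graph of h_L: [u] lies in the domain, H^1_0 and H^2, and
   [w] = - Delta u + v u. *)
Definition schrodinger v (L : R) u w : Prop :=
  [/\ H10 (square L) u, H2 (square L) u &
    exists2 d : 'I_2 -> plane R -> R,
      forall i, exists2 g, weak_partial (square L) i u g &
                           weak_partial (square L) i g (d i) &
      {ae lebesgue2, forall z, square L z ->
        w z = - (\sum_(i < 2) d i z) + v z * u z}].

Definition hilbert_basis Omega (psi : nat -> plane R -> R) : Prop :=
  [/\ forall k, L2 Omega (psi k),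
      forall j k, inner Omega (psi j) (psi k) = (j == k)%:R &
      forall f, L2 Omega f ->
        norm2 Omega (fun z =>
          f z - \sum_(k < n) inner Omega f (psi k) * psi k z)
          @[n --> \oo] --> 0%E].

(* h_L has purely discrete spectrum, and lam 0 <= lam 1 <= ... are its
   eigenvalues counted with multiplicity: they belong to an orthonormal basis
   of eigenfunctions, so that each value occurs in [lam] as many times as the
   dimension of its eigenspace. *)
Definition eigenvalues v (L : R) (lam : nat -> R) : Prop :=
  [/\ {homo lam : j k / (j <= k)%N >-> j <= k},
      lam k @[k --> \oo] --> +oo &
      exists2 psi, hilbert_basis (square L) psi &
        forall k, schrodinger v L (psi k) (fun z => lam k * psi k z)].

Definition spectral_gap (lam : nat -> R) : R := lam 1%N - lam 0%N.

End Definitions.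

(* Main.v *)
Require Import Defs.
From mathcomp Require Import all_boot all_order all_algebra.
From mathcomp Require Import all_classical all_reals all_analysis.
From mathcomp Require Import measurable_realfun ess_sup_inf ring lra.
(** On the scale of the square the strip acts as a Dirichlet wall: it cuts the
    square of side L into two nearly congruent rectangles of sides L/2 and L,
    so that the two lowest eigenvalues have the same leading term, the ground
    energy (2 pi / L)^2 + (pi / L)^2 = 5 pi^2 / L^2 of such a rectangle.  For
    each theta in (0, 1) and all large L we show that
    [theta^2 * 5 pi^2 / L^2 <= lam 0] and [lam 1 <= 5 pi^2 / (theta^3 L^2)], so
    that L^2 times the gap is at most 5 pi^2 (theta^-3 - theta^2), a quantity
    that is small when theta is near 1 ([theta_of_epsilon]); the gap itself is
    nonnegative.

    Upper bound for [lam 1].  If a trial function f is orthogonal to the ground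
    state, expanding f and h f in the eigenbasis gives
    [lam 1 * |f|^2 <= (h f, f)] ([second_eigenvalue_le_form]).  Two trial
    functions with disjoint supports span a plane, which contains such an f, and
    there are no cross terms, so that the larger of their Rayleigh quotients
    bounds [lam 1] ([second_eigenvalue_le_rayleigh]).  One trial function lives
    in each of the two rectangles left free by the strip, where the potential
    vanishes.  Being a test function, it enters the weak equation of every
    eigenfunction directly ([schrodinger_weak]).  It is a product of two sines,
    each composed with a smooth approximation G of the positive part: G vanishes
    below eta, G' lies between 0 and 1, and G(t) >= t - 2 eta, so that the
    gradient does not increase and the mass hardly drops
    ([interval_trial_exists], [rectangle_trial_exists]).

    Lower bound for [lam 0].  If F' + F^2 <= m on an interval then
    (f' - f F)^2 >= 0 and an integration of (f^2 F)' give
    int f'^2 + m int f^2 >= f(b)^2 F(b) - f(a)^2 F(a)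
    ([riccati_lower_bound]; F plays the part of the logarithmic derivative of a
    positive supersolution).  Outside the strip F = - k tan (k (x -+ L/4)) with
    k = 2 pi theta / L, inside F is linear and odd, with slope chosen so that
    the jumps of F at the edges of the strip have a favourable sign; since k
    tends to 0, the Riccati inequality inside the strip holds as soon as L is
    large ([slice_strip]).  Together with the analogous bound in the y direction
    ([slice_friedrichs]) and Tonelli's theorem, this bounds the energy of every
    test function from below.  The ground state is a limit of test functions in
    the norm of H^1, and its weak equation transfers the bound to [lam 0]
    ([eigenvalue_lower_bound]). *)

Set Implicit Arguments.
Unset Strict Implicit.
Unset Printing Implicit Defensive.
Import Order.TTheory GRing.Theory Num.Theory.
Import numFieldNormedType.Exports.
Local Open Scope classical_set_scope.
Local Open Scope ring_scope.

(** * The inner product of square-integrable functions *)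

Section L2Algebra.
Context {R : realType}.
Implicit Types (Omega : set (plane R)) (f g h : plane R -> R).

Lemma restrict_mul Omega f g : (f \* g) \_ Omega = (f \_ Omega) \* (g \_ Omega).
Proof.
by apply/funext => z; rewrite /patch /=; case: ifP => _ //; rewrite mulr0.
Qed.

Lemma restrict_comb Omega (a b : R) f g :
  (fun z => a * f z + b * g z) \_ Omega =
  (fun z => a * (f \_ Omega) z + b * (g \_ Omega) z).
Proof.
by apply/funext => z; rewrite /patch /=; case: ifP => _ //; rewrite !mulr0 addr0.
Qed.

Lemma L2_measurable Omega f : L2 Omega f -> measurable_fun setT (f \_ Omega).
Proof. by move=> /sub_Lfun_mfun; rewrite inE. Qed.

Lemma norm2_sqr Omega f :
  (norm2 Omega f `^ 2 = \int[lebesgue2]_z (((f \_ Omega) z) ^+ 2)%:E)%E.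
Proof.
rewrite /norm2 powR_Lnorm ?pnatr_eq0//; apply: eq_integral => z _.
by rewrite -[2]/(2%:R) /= powR_mulrn ?normr_ge0// real_normK ?num_real.
Qed.

(** Turns finiteness of the norm, which involves real powers of extended reals,
    into integrability of the square, where domination can be used. *)
Lemma L2P Omega f : L2 Omega f <->
  measurable_fun setT (f \_ Omega) /\
  lebesgue2.-integrable setT (EFin \o (fun z => (f \_ Omega) z ^+ 2)).
Proof.
split=> [Lf|[mf /integrableP[mf2 If]]].
  by split; [exact: L2_measurable|exact: Lfun2_integrable_sqr].
rewrite /L2 inE; apply/andP; split; rewrite inE//= /finite_norm.
have : (norm2 Omega f `^ 2 < +oo)%E.
  rewrite norm2_sqr; apply: le_lt_trans If; rewrite le_eqVlt; apply/orP; left.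
  apply/eqP; apply: eq_integral => z _.
  by rewrite gee0_abs//= lee_fin sqr_ge0.
rewrite /norm2; move: (Lnorm_ge0 lebesgue2 2%:E (EFin \o (f \_ Omega))).
by case: ('N[_]__[_])%E => [r||] //=; rewrite ?ltry ?pnatr_eq0.
Qed.

Lemma L2_comb Omega (a b : R) f g : L2 Omega f -> L2 Omega g ->
  L2 Omega (fun z => a * f z + b * g z).
Proof.
move=> Lf Lg; rewrite /L2 restrict_comb.
have l12 : 1 <= 2 :> R by rewrite ler1n.
have le12 : (1 <= 2%:E :> \bar R)%E by rewrite lee_fin.
have Ls c h : L2 Omega h -> (fun z => c * (h \_ Omega) z) \in Lfun lebesgue2 2%:E.
  move=> Lh; rewrite (_ : (fun _ => _) = c \o* (h \_ Omega)); last first.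
    by apply/funext => z /=; rewrite mulrC.
  exact: Lfun_scale.
exact: ((Lfun_addr_closed lebesgue2 le12).2 _ _ (Ls a f Lf) (Ls b g Lg)).
Qed.

Lemma L2D Omega f g : L2 Omega f -> L2 Omega g -> L2 Omega (f \+ g).
Proof.
move=> Lf Lg; have := L2_comb 1 1 Lf Lg; congr (L2 _ _).
by apply/funext => z /=; rewrite !mul1r.
Qed.

Lemma L2B Omega f g : L2 Omega f -> L2 Omega g -> L2 Omega (f \- g).
Proof.
move=> Lf Lg; have := L2_comb 1 (-1) Lf Lg; congr (L2 _ _).
by apply/funext => z /=; rewrite mul1r mulN1r.
Qed.

Lemma L2_integrable Omega f g : L2 Omega f -> L2 Omega g ->
  lebesgue2.-integrable setT (EFin \o ((f \_ Omega) \* (g \_ Omega))).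
Proof. by move=> Lf Lg; apply/Lfun1_integrable; exact: Lfun2_mul_Lfun1. Qed.

Lemma innerE Omega f g :
  inner Omega f g = \int[lebesgue2]_z ((f \_ Omega) z * (g \_ Omega) z).
Proof. by rewrite /inner Rintegral_mkcond restrict_mul. Qed.

Lemma innerC Omega f g : inner Omega f g = inner Omega g f.
Proof. by apply: eq_Rintegral => z _; rewrite mulrC. Qed.

Lemma inner_combl Omega (a b : R) f g h :
  L2 Omega f -> L2 Omega g -> L2 Omega h ->
  inner Omega (fun z => a * f z + b * g z) h =
  a * inner Omega f h + b * inner Omega g h.
Proof.
move=> Lf Lg Lh; rewrite !innerE restrict_comb.
have If := L2_integrable Lf Lh; have Ig := L2_integrable Lg Lh.
rewrite -RintegralZl// -RintegralZl// -RintegralD//; last 2 first.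
- exact: (integrableZl measurableT a If).
- exact: (integrableZl measurableT b Ig).
by apply: eq_Rintegral => z _; rewrite mulrDl !mulrA.
Qed.

Lemma inner_combr Omega (a b : R) f g h :
  L2 Omega f -> L2 Omega g -> L2 Omega h ->
  inner Omega h (fun z => a * f z + b * g z) =
  a * inner Omega h f + b * inner Omega h g.
Proof. by move=> *; rewrite innerC inner_combl// !(innerC _ h). Qed.

Lemma innerBl Omega f g h : L2 Omega f -> L2 Omega g -> L2 Omega h ->
  inner Omega (f \- g) h = inner Omega f h - inner Omega g h.
Proof.
move=> Lf Lg Lh; have := inner_combl 1 (-1) Lf Lg Lh.
by rewrite mul1r mulN1r => <-; apply: eq_Rintegral => z _ /=; rewrite mul1r mulN1r.
Qed.

Lemma innerBr Omega f g h : L2 Omega f -> L2 Omega g -> L2 Omega h ->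
  inner Omega h (f \- g) = inner Omega h f - inner Omega h g.
Proof. by move=> *; rewrite innerC innerBl// !(innerC _ h). Qed.

Lemma innerDl Omega f g h : L2 Omega f -> L2 Omega g -> L2 Omega h ->
  inner Omega (f \+ g) h = inner Omega f h + inner Omega g h.
Proof.
move=> Lf Lg Lh; have := inner_combl 1 1 Lf Lg Lh.
by rewrite !mul1r => <-; apply: eq_Rintegral => z _ /=; rewrite !mul1r.
Qed.

Lemma inner_ge0 Omega f : 0 <= inner Omega f f.
Proof. by apply: Rintegral_ge0 => z _; rewrite -expr2 sqr_ge0. Qed.

(** From the nonnegativity of the form on all combinations of the two functions;
    the degenerate case where g has norm 0 is settled by a coefficient that makes
    the form negative unless the product vanishes. *)
Lemma Cauchy_Schwarz Omega f g : L2 Omega f -> L2 Omega g ->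
  inner Omega f g ^+ 2 <= inner Omega f f * inner Omega g g.
Proof.
move=> Lf Lg; set A := inner _ f f; set B := inner _ f g; set C := inner _ g g.
have key a b : 0 <= a ^+ 2 * A + 2 * a * b * B + b ^+ 2 * C.
  have Lab := L2_comb a b Lf Lg.
  have := inner_ge0 Omega (fun z => a * f z + b * g z).
  rewrite inner_combl// !inner_combr// -/A -/C -/B (innerC _ g f) -/B.
  by congr (_ <= _); ring.
have A0 : 0 <= A by exact: inner_ge0.
have C0 : 0 <= C by exact: inner_ge0.
have [CA|CA] := ltP 0 C.
  have := key C (- B); have -> : C ^+ 2 * A + 2 * C * - B * B + (- B) ^+ 2 * C =
    C * (A * C - B ^+ 2) by ring.
  by rewrite pmulr_rge0// subr_ge0.
have C0' : C = 0 by apply/eqP; rewrite eq_le CA C0.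
have [B0|B0] := eqVneq B 0; first by rewrite B0 C0' mulr0 expr0n.
(* at these coefficients the form takes the value - A - 2 < 0 *)
have := key 1 (- (A + 1) / B); rewrite C0' mulr0 addr0.
have -> : 1 ^+ 2 * A + 2 * 1 * (- (A + 1) / B) * B = - A - 2.
  by field.
lra.
Qed.

(** Brings smallness in norm back to [inner], with which all later estimates are
    algebra. *)
Lemma norm2_lt Omega f (e : R) : L2 Omega f -> 0 < e ->
  (norm2 Omega f < e%:E)%E -> inner Omega f f < e ^+ 2.
Proof.
move=> Lf e0 fe; rewrite innerE.
have /integrableP[mf2 If] := Lfun2_integrable_sqr Lf.
rewrite /Rintegral -lte_fin fineK; last first.
  by apply: integrable_fin_num => //; exact: L2_integrable.
under eq_integral do rewrite -expr2.
rewrite -norm2_sqr; move: fe; rewrite /norm2.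
have := Lnorm_ge0 lebesgue2 2%:E (EFin \o (f \_ Omega)).
case: ('N[_]__[_])%E => [r||] //=; rewrite !lee_fin !lte_fin => r0 re.
by rewrite -[2 : R]/(2%:R) powR_mulrn// ltr_pXn2r// nnegrE ltW.
Qed.

End L2Algebra.

(** * Measurability in the plane *)

Section TestFunctions.
Context {R : realType}.
Implicit Types (Omega : set (plane R)) (f g phi : plane R -> R).

(** The product sigma-algebra contains the Borel sets because every open set is a
    countable union of boxes with rational corners. *)
Lemma open_measurable_plane (U : set (R * R)) :
  open U -> measurable (U : set (plane R)).
Proof.
move=> oU.
pose box (q : (rat * rat) * (rat * rat)) : set (plane R) :=
  `]ratr q.1.1, ratr q.1.2[ `*` `]ratr q.2.1, ratr q.2.2[.
pose D : set ((rat * rat) * (rat * rat)) := [set q | box q `<=` U].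
have -> : U = \bigcup_(q in D) box q.
  apply/seteqP; split => [[x y] Uxy|z [q Dq]]; last exact: Dq.
  have /nbhs_ballP[e /= e0 eU] := open_nbhs_nbhs (conj oU Uxy).
  have [a /[!in_itv]/= /andP[ax ax']] := @rat_in_itvoo R (x - e) x ltac:(lra).
  have [b /[!in_itv]/= /andP[bx bx']] := @rat_in_itvoo R x (x + e) ltac:(lra).
  have [c /[!in_itv]/= /andP[cx cx']] := @rat_in_itvoo R (y - e) y ltac:(lra).
  have [d /[!in_itv]/= /andP[dx dx']] := @rat_in_itvoo R y (y + e) ltac:(lra).
  exists ((a, b), (c, d)); last by split; rewrite /= in_itv/=; apply/andP.
  move=> [s t] [/=]; rewrite !in_itv/= => /andP[s1 s2] /andP[t1 t2].
  by apply: eU; split; rewrite /ball/= ltr_norml; apply/andP; split; lra.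
rewrite bigcup_mkcond; apply: countable_bigcupT_measurable; first exact: countableP.
by move=> q; case: ifP => _ //; apply: measurableX; exact: measurable_itv.
Qed.

Lemma continuous_measurable_plane (phi : R * R -> R) :
  continuous phi -> measurable_fun [set: plane R] phi.
Proof.
move=> /continuousP cphi.
apply: (measurability _ (RGenOpens.measurableE R)).
move=> _ [_ [a [b ->]] <-]; rewrite setTI.
apply: open_measurable_plane; apply: cphi; exact: interval_open.
Qed.

Lemma measurable_square (L : R) : measurable (square L).
Proof. by apply: measurableX; exact: measurable_itv. Qed.

Lemma lebesgue2_rect (I J : set (measurableTypeR R)) : measurable I -> measurable J ->
  lebesgue2 (I `*` J : set (plane R)) = (lebesgue_measure I * lebesgue_measure J)%E.
Proof. exact: product_measure1E. Qed.

Lemma square_fin (L : R) : (lebesgue2 (square L) < +oo)%E.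
Proof.
rewrite lebesgue2_rect; [|exact: measurable_itv|exact: measurable_itv].
by rewrite !lebesgue_measure_itv/=; case: ifP => _; rewrite ?mule0// -EFinM ltry.
Qed.

Lemma L2_bounded (L M : R) f : measurable_fun setT f ->
  (forall z, `|f z| <= M) -> L2 (square L) f.
Proof.
move=> mf fM; apply/L2P.
have mr : measurable_fun setT (f \_ (square L)).
  apply/(measurable_restrictT f (measurable_square L)).
  exact: measurable_funTS.
split => //.
have I1 : lebesgue2.-integrable setT
    (EFin \o (fun z => ((cst (M ^+ 2)) \_ (square L)) z)).
  rewrite -restrict_EFin; apply/integrable_restrict => //.
    exact: measurable_square.
  rewrite setTI.
  apply/integrableP; split; first by apply/measurable_EFinP; exact: measurable_cst.
  rewrite (eq_integral (cst `|(M ^+ 2)%:E|%E))//.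
  rewrite integral_cst//; last exact: measurable_square.
  by rewrite lte_mul_pinfty// square_fin.
apply: le_integrable I1 => //.
  by apply/measurable_EFinP; exact: measurable_funX.
move=> z _ /=; rewrite lee_fin /patch; case: ifP => _; last first.
  by rewrite expr0n.
by rewrite !ger0_norm ?sqr_ge0// -ler_sqrt ?sqr_ge0// !sqrtr_sqr (le_trans (fM z))// ler_norm.
Qed.

Lemma L2_mul (L M : R) (w f : plane R -> R) : measurable_fun setT w -> (forall z, 0 <= w z <= M) ->
  L2 (square L) f -> L2 (square L) (w \* f).
Proof.
move=> mw wM /L2P[mf If]; apply/L2P.
have E : (w \* f) \_ (square L) = w \* (f \_ (square L)).
  by apply/funext => z; rewrite /patch /=; case: ifP => _ //; rewrite mulr0.
have mwf : measurable_fun setT ((w \* f) \_ (square L)).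
  by rewrite E; exact: measurable_funM.
split => //.
apply: le_integrable (integrableZl measurableT (M ^+ 2) If) => //.
  by apply/measurable_EFinP; exact: measurable_funX.
move=> z _ /=; rewrite E /= lee_fin exprMn normrM [in leRHS]normrM ler_wpM2r//.
have /andP[w0 wMz] := wM z.
by rewrite !ger0_norm ?sqr_ge0// ler_pXn2r// nnegrE (le_trans w0).
Qed.

End TestFunctions.

(** * Test functions *)

Section TestFunctionsL2.
Context {R : realType}.
Implicit Types (Omega : set (R * R)) (phi : R * R -> R).

Lemma smooth_continuous phi : smooth phi -> continuous phi.
Proof. by move=> /(_ [::])[]. Qed.

Lemma smooth_derivable phi i z : smooth phi -> derivable phi z (axis i).
Proof. by move=> /(_ [::])[_ /(_ i z)]. Qed.

Lemma smooth_partial i phi : smooth phi -> smooth (partial i phi).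
Proof.
move=> sphi s; have := sphi (rcons s i).
by rewrite /iter_partial foldr_rcons.
Qed.

Lemma test_function_eq0 Omega phi z :
  test_function Omega phi -> ~ Omega z -> phi z = 0.
Proof.
move=> [_ _ sO] nO; apply/eqP; apply/negPn/negP => /eqP phi0; apply: nO.
by apply: sO; apply: subset_closure => /=; apply/eqP.
Qed.

(** Off the closed support the function vanishes near the point, and so does its
    derivative. *)
Lemma partial_supp i phi :
  closure [set z | partial i phi z != 0] `<=` closure [set z | phi z != 0].
Proof.
rewrite [X in _ `<=` X](closure_id _).1; last exact: closed_closure.
apply: closure_subset => z /= dphi; apply: contrapT => nz.
have oC : open (~` closure [set z | phi z != 0]).
  by apply: closed_openC; exact: closed_closure.
move/negP: dphi; apply; apply/eqP.
rewrite /partial (@near_eq_derive _ _ _ phi (cst 0)); first exact: derive_cst.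
near=> t; apply/eqP/negPn/negP => phit.
have : (~` closure [set z | phi z != 0]) t by near: t; exact: open_nbhs_nbhs.
by apply; exact: subset_closure.
Unshelve. all: by end_near. Qed.

Lemma test_function_partial Omega i phi :
  test_function Omega phi -> test_function Omega (partial i phi).
Proof.
move=> [sphi cphi ophi]; split; first exact: smooth_partial.
- apply: (subclosed_compact _ cphi); first exact: closed_closure.
  exact: partial_supp.
- by apply: subset_trans ophi; exact: partial_supp.
Qed.

Lemma test_function_bounded Omega phi :
  test_function Omega phi -> exists M : R, forall z, `|phi z| <= M.
Proof.
move=> [sphi cphi _].
have cphi' := smooth_continuous sphi.
have /compact_bounded : compact (phi @` closure [set z | phi z != 0]).
  by apply: continuous_compact => //; exact: continuous_subspaceT.
move=> [M [_ MP]]; exists (Num.max (M + 1) 0) => z.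
have [->|phi0] := eqVneq (phi z) 0; first by rewrite normr0 le_max lexx orbT.
rewrite le_max; apply/orP; left; apply: (MP (M + 1)); first lra.
by exists z => //; exact: subset_closure.
Qed.

Lemma test_function_L2 L phi :
  test_function (square L) phi -> L2 (square L) phi.
Proof.
move=> tphi; have [M phiM] := test_function_bounded tphi.
apply: (@L2_bounded R L M phi _ phiM); apply: continuous_measurable_plane.
by case: tphi => /smooth_continuous.
Qed.

End TestFunctionsL2.

(** * The Riccati inequality on an interval *)

Section OneDim.
Context {R : realType}.
Implicit Types (a b c k m : R) (f df F dF : R -> R).

Local Notation mu := (@lebesgue_measure R).

Lemma continuous_within_itv a b f : {in `[a, b], continuous f} ->
  {within `[a, b], continuous f}.
Proof. by move=> cf; apply: continuous_in_subspaceT => x /[!inE]; exact: cf. Qed.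

Lemma continuous_integrable_itv a b f : {in `[a, b], continuous f} ->
  mu.-integrable `[a, b] (EFin \o f).
Proof.
move=> cf; apply: continuous_compact_integrable; first exact: segment_compact.
exact: continuous_within_itv.
Qed.

Lemma is_derive_continuous f (x l : R) : is_derive x (1 : R) f l -> {for x, continuous f}.
Proof. by move=> [df _]; apply: differentiable_continuous; apply/derivable1_diffP. Qed.

Lemma Rintegral_derivative a b f df : a < b ->
  {in `[a, b], forall x, is_derive x (1 : R) f (df x)} ->
  {in `[a, b], continuous df} ->
  \int[mu]_(x in `[a, b]) df x = f b - f a.
Proof.
move=> ab fdf cdf; rewrite /Rintegral (@continuous_FTC2 R df f a b ab)//=.
- exact: continuous_within_itv.
- split.
  + move=> x xab; have /fdf[] // : x \in `[a, b].
    by apply: subset_itv_oo_cc.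
  + apply: cvg_at_right_filter; apply: is_derive_continuous (fdf a _).
    by rewrite in_itv/= lexx ltW.
  + apply: cvg_at_left_filter; apply: is_derive_continuous (fdf b _).
    by rewrite in_itv/= lexx ltW.
- move=> x xab; rewrite derive1E.
  by have /fdf[] // : x \in `[a, b] by apply: subset_itv_oo_cc.
Qed.

(** Integrates (f^2 F)' = 2 f f' F + f^2 F' <= f'^2 + f^2 (F' + F^2), which is
    (f' - f F)^2 >= 0. *)
Lemma riccati_lower_bound a b m f df F dF : a < b ->
  (forall x, is_derive x (1 : R) f (df x)) -> continuous df ->
  {in `[a, b], forall x, is_derive x (1 : R) F (dF x)} ->
  {in `[a, b], continuous dF} ->
  {in `[a, b], forall x, dF x + F x ^+ 2 <= m} ->
  f b ^+ 2 * F b - f a ^+ 2 * F a <=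
  \int[mu]_(x in `[a, b]) (df x ^+ 2 + m * f x ^+ 2).
Proof.
move=> ab fdf cdf FdF cdF dFm.
have cf : continuous f by move=> x; exact: is_derive_continuous (fdf x).
have cF : {in `[a, b], continuous F}.
  by move=> x xab; exact: is_derive_continuous (FdF x xab).
pose G x := f x ^+ 2 * F x.
pose dG x := 2 * f x * df x * F x + f x ^+ 2 * dF x.
have GdG : {in `[a, b], forall x, is_derive x (1 : R) G (dG x)}.
  move=> x xab; have := FdF x xab => FdFx; have := fdf x => fdfx.
  rewrite /G; apply: is_derive_eq.
  by rewrite /dG /GRing.scale /=; ring.
have cdG : {in `[a, b], continuous dG}.
  move=> x xab; rewrite /dG.
  apply: cvgD; apply: cvgM => //; [|exact: cF|apply: cvgM; exact: cf|exact: cdF].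
  by apply: cvgM; [apply: cvgM; [exact: cvg_cst|exact: cf]|exact: cdf].
rewrite -[leLHS](Rintegral_derivative ab GdG cdG).
apply: le_Rintegral => //.
- exact: continuous_integrable_itv.
- apply: continuous_integrable_itv => x xab.
  apply: cvgD; first by apply: cvgM; exact: cdf.
  by apply: cvgM; [exact: cvg_cst|apply: cvgM; exact: cf].
move=> x xab; have := dFm x xab; rewrite /dG => H.
have H1 := ler_wpM2r (sqr_ge0 (f x)) H.
have := sqr_ge0 (df x - f x * F x); rewrite sqrrB => H2.
lra.
Qed.

End OneDim.

(** * Energy lower bounds on horizontal and vertical slices *)

Section Slices.
Context {R : realType}.
Implicit Types (a b c k m : R) (f df F dF : R -> R).

Local Notation mu := (@lebesgue_measure R).

Lemma Rintegral_energy a b m f df : continuous f -> continuous df ->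
  \int[mu]_(x in `[a, b]) (df x ^+ 2 + m * f x ^+ 2) =
  \int[mu]_(x in `[a, b]) df x ^+ 2 + m * \int[mu]_(x in `[a, b]) f x ^+ 2.
Proof.
move=> cf cdf.
have sq (g : R -> R) : continuous g -> mu.-integrable `[a, b] (EFin \o (fun x => g x ^+ 2)).
  move=> cg; apply: continuous_integrable_itv => x _; apply: cvgM; exact: cg.
rewrite RintegralD//; [|exact: sq|]; last first.
  apply: continuous_integrable_itv => x _; apply: cvgM; first exact: cvg_cst.
  by apply: cvgM; exact: cf.
by rewrite RintegralZl//; exact: sq.
Qed.

(** F = - k tan (k (x - c)) is the logarithmic derivative of cos (k (x - c)), so
    F' + F^2 = - k^2. *)
Lemma riccati_tan a b c k (t : R) f df : a < b -> t < pi / 2 ->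
  (forall x, is_derive x (1 : R) f (df x)) -> continuous df ->
  {in `[a, b], forall x, `|k * (x - c)| <= t} ->
  f a ^+ 2 * (k * tan (k * (a - c))) - f b ^+ 2 * (k * tan (k * (b - c))) +
    k ^+ 2 * \int[mu]_(x in `[a, b]) f x ^+ 2 <=
  \int[mu]_(x in `[a, b]) df x ^+ 2.
Proof.
move=> ab tpi fdf cdf kxt.
have cf : continuous f by move=> x; exact: is_derive_continuous (fdf x).
pose F x := - (k * tan (k * (x - c))).
pose dF x := - (k ^+ 2 * (1 + tan (k * (x - c)) ^+ 2)).
have cos0 x : x \in `[a, b] -> cos (k * (x - c)) != 0.
  move=> /kxt; rewrite ler_norml => /andP[h1 h2].
  by rewrite gt_eqF// cos_gt0_pihalf//; apply/andP; split; lra.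
have dlin x : is_derive x (1 : R) (fun x => k * (x - c)) k.
  by apply: is_derive_eq; rewrite /GRing.scale /=; ring.
have FdF : {in `[a, b], forall x, is_derive x (1 : R) F (dF x)}.
  move=> x xab.
  have H := @is_derive1_comp R tan (fun x => k * (x - c)) x _ _
    (is_derive_tan (cos0 x xab)) (dlin x).
  rewrite (_ : F = - (k *: (tan \o (fun x => k * (x - c))))); last first.
    by apply/funext => y.
  apply: is_derive_eq.
  by rewrite /dF cos2_tan2 ?cos0// /GRing.scale /=; ring.
have cdF : {in `[a, b], continuous dF}.
  move=> x xab; have cF := is_derive_continuous (FdF x xab).
  have -> : dF = (fun x => - (k ^+ 2 + F x * F x)).
    by apply/funext => y; rewrite /dF /F; ring.
  by apply: cvgN; apply: cvgD; [exact: cvg_cst|apply: cvgM].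
have := riccati_lower_bound ab fdf cdf FdF cdF (m := - k ^+ 2).
rewrite Rintegral_energy// => H.
have {H} := H _; rewrite /F => H.
suff : {in `[a, b], forall x, dF x + F x ^+ 2 <= - k ^+ 2}.
  by move=> /H; lra.
by move=> x _; rewrite /dF /F le_eqVlt; apply/orP; left; apply/eqP; ring.
Qed.

(** The frequency is a little smaller than pi / L, so that the tangent stays
    bounded up to the ends of the interval. *)
Lemma slice_friedrichs (L theta : R) f df : 0 < L -> 0 < theta < 1 ->
  (forall x, is_derive x (1 : R) f (df x)) -> continuous df ->
  f (- (L / 2)) = 0 -> f (L / 2) = 0 ->
  (pi * theta / L) ^+ 2 * \int[mu]_(x in `[(- (L / 2)), (L / 2)]) f x ^+ 2 <=
  \int[mu]_(x in `[(- (L / 2)), (L / 2)]) df x ^+ 2.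
Proof.
move=> L0 /andP[t0 t1] fdf cdf fa fb.
have pi0 : 0 < pi :> R := pi_gt0 R.
have := @riccati_tan (- (L / 2)) (L / 2) 0 (pi * theta / L) (pi * theta / 2) f df.
rewrite fa fb expr0n/= !mul0r subr0 add0r; apply => //; first lra.
  by rewrite ltr_pM2r ?invr_gt0// gtr_pMr.
move=> x; rewrite in_itv/= => /andP[x1 x2]; rewrite subr0.
have k0 : 0 < pi * theta / L by rewrite divr_gt0// mulr_gt0.
rewrite normrM gtr0_norm//.
have -> : pi * theta / 2 = pi * theta / L * (L / 2) by field; lra.
by rewrite ler_pM2l// ler_norml x1 x2.
Qed.

(** The term in gamma is the potential on the strip.  The two halves outside the
    strip are compared with cosines centred at -L/4 and L/4, and the strip with
    F x = tau x / delta.  At x = delta the function F jumps down from tau to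
    k tan (k (L/4 - delta)) <= tau, and symmetrically at - delta, so the boundary
    terms add up to a nonnegative quantity. *)
Lemma slice_strip (L delta gamma theta : R) f df :
  let k := 2 * pi * theta / L in
  let tau := k * tan (pi * theta / 2) in
  0 < L -> 0 < theta < 1 -> 0 < delta -> delta < L / 2 ->
  tau / delta + tau ^+ 2 <= gamma - k ^+ 2 ->
  (forall x, is_derive x (1 : R) f (df x)) -> continuous df ->
  f (- (L / 2)) = 0 -> f (L / 2) = 0 ->
  k ^+ 2 * \int[mu]_(x in `[(- (L / 2)), (- delta)]) f x ^+ 2 +
  k ^+ 2 * \int[mu]_(x in `[(- delta), delta]) f x ^+ 2 +
  k ^+ 2 * \int[mu]_(x in `[delta, (L / 2)]) f x ^+ 2 <=
  \int[mu]_(x in `[(- (L / 2)), (- delta)]) df x ^+ 2 +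
  (\int[mu]_(x in `[(- delta), delta]) df x ^+ 2 +
   gamma * \int[mu]_(x in `[(- delta), delta]) f x ^+ 2) +
  \int[mu]_(x in `[delta, (L / 2)]) df x ^+ 2.
Proof.
move=> k tau L0 /andP[t0 t1] d0 dL taug fdf cdf fa fb.
have cf : continuous f by move=> x; exact: is_derive_continuous (fdf x).
have pi0 : 0 < pi :> R := pi_gt0 R.
have k0 : 0 < k by rewrite /k divr_gt0// !mulr_gt0.
have tpi : pi * theta / 2 < pi / 2 :> R by rewrite ltr_pM2r ?invr_gt0// gtr_pMr.
have kE : pi * theta / 2 = k * (L / 4) by rewrite /k; field; lra.
have kle (c x : R) : `|x - c| <= L / 4 -> `|k * (x - c)| <= pi * theta / 2.
  by move=> h; rewrite normrM gtr0_norm// kE ler_pM2l.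
have H1 := @riccati_tan (- (L / 2)) (- delta) (- (L / 4)) k (pi * theta / 2) f df.
have {}H1 := H1 ltac:(lra) tpi fdf cdf _.
have {H1} := H1 _; rewrite fa expr0n/= mul0r => H1.
have {}H1 : - (f (- delta) ^+ 2 * (k * tan (k * (L / 4 - delta)))) +
    k ^+ 2 * \int[mu]_(x in `[(- (L / 2)), (- delta)]) f x ^+ 2 <=
    \int[mu]_(x in `[(- (L / 2)), (- delta)]) df x ^+ 2.
  have -> : L / 4 - delta = - delta - (- (L / 4)) by lra.
  rewrite -[X in X + _]sub0r; apply: H1 => x; rewrite in_itv/= => /andP[x1 x2].
  by apply: kle; rewrite ler_norml; apply/andP; split; lra.
have H3 := @riccati_tan delta (L / 2) (L / 4) k (pi * theta / 2) f df.
have {}H3 := H3 dL tpi fdf cdf _.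
have {H3} := H3 _; rewrite fb expr0n/= mul0r subr0 => H3.
have {}H3 : - (f delta ^+ 2 * (k * tan (k * (L / 4 - delta)))) +
    k ^+ 2 * \int[mu]_(x in `[delta, (L / 2)]) f x ^+ 2 <=
    \int[mu]_(x in `[delta, (L / 2)]) df x ^+ 2.
  have E : k * tan (k * (delta - L / 4)) = - (k * tan (k * (L / 4 - delta))).
    by rewrite -[RHS]mulrN -tanN; congr (_ * tan _); ring.
  rewrite -mulrN -E; apply: H3 => x; rewrite in_itv/= => /andP[x1 x2].
  by apply: kle; rewrite ler_norml; apply/andP; split; lra.
have dd : - delta < delta by lra.
(* the slope makes F delta = tau *)
pose F x := tau / delta * x.
have tau0 : 0 <= tau.
  rewrite /tau mulr_ge0 ?(ltW k0)// /tan divr_ge0//.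
    by rewrite sin_ge0_pi//; apply/andP; split; nra.
  by rewrite cos_ge0_pihalf//; apply/andP; split; nra.
have FdF : {in `[(- delta), delta], forall x, is_derive x (1 : R) F (tau / delta)}.
  by move=> x _; apply: is_derive_eq; rewrite /GRing.scale /= mulr1.
have := riccati_lower_bound (m := gamma - k ^+ 2) dd fdf cdf FdF (dF := fun=> tau / delta).
rewrite Rintegral_energy// => H2.
have {}H2 := H2 (fun _ _ => cvg_cst _) _.
have {H2} := H2 _; rewrite /F mulrN divfK ?gt_eqF// => H2.
have {}H2 : f delta ^+ 2 * tau - f (- delta) ^+ 2 * - tau <=
  \int[mu]_(x in `[(- delta), delta]) df x ^+ 2 +
   (gamma - k ^+ 2) * \int[mu]_(x in `[(- delta), delta]) f x ^+ 2.
  apply: H2 => x; rewrite in_itv/= => /andP[x1 x2].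
  apply: le_trans taug; rewrite lerD2l /F.
  rewrite -ler_sqrt ?sqr_ge0// !sqrtr_sqr normrM.
  rewrite (ger0_norm (divr_ge0 tau0 (ltW d0))) (ger0_norm tau0).
  rewrite -[leRHS](divfK (lt0r_neq0 d0)) ler_wpM2l// ?divr_ge0// ?(ltW d0)//.
  by rewrite ler_norml x1 x2.
have T : k * tan (k * (L / 4 - delta)) <= tau.
  rewrite /tau ler_pM2l// kE.
  have h : k * (L / 4 - delta) < k * (L / 4) by rewrite ltr_pM2l//; lra.
  have h2 : - (k * (L / 4)) < k * (L / 4 - delta).
    by rewrite -mulrN ltr_pM2l//; lra.
  by apply/ltW; rewrite ltr_tan// in_itv/=; apply/andP; split; lra.
have T1 := ler_wpM2l (sqr_ge0 (f delta)) T.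
have T2 := ler_wpM2l (sqr_ge0 (f (- delta))) T.
lra.
Qed.

End Slices.

(** * Slice bounds as Lebesgue integrals over the line *)

Section Tonelli.
Context {R : realType}.
Implicit Types (f df w : R -> R).

Local Notation mu := (@lebesgue_measure R).

Lemma integral_cover3 (b1 b2 b3 b4 : R) (h : R -> \bar R) :
  b1 < b2 -> b2 < b3 -> b3 < b4 ->
  measurable_fun [set: measurableTypeR R] h -> (forall x, 0 <= h x)%E ->
  (\int[mu]_(x in `[b1, b4]) h x =
   \int[mu]_(x in `[b1, b2]) h x + (\int[mu]_(x in `[b2, b3]) h x +
   \int[mu]_(x in `[b3, b4]) h x))%E.
Proof.
move=> b12 b23 b34 mh h0.
have mhS (D : set (measurableTypeR R)) : measurable_fun D h by exact: measurable_funTS.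
rewrite -(integral_itv_obnd_cbnd (mhS [set` `]b2, b3]])).
rewrite -(integral_itv_bndo_bndc (mhS [set` `]b2, b3[])).
rewrite -ge0_integral_setU//; last first.
  apply/disj_setPS => x [/=]; rewrite !in_itv/= => /andP[_ x1] /andP[x2 _].
  by have := lt_le_trans x1 x2; rewrite ltxx.
rewrite -ge0_integral_setU//; last first.
  apply/disj_setPS => x [/=]; rewrite !in_itv/= => /andP[_ x1] [/andP[x2 _]|/andP[x2 _]].
    by have := le_lt_trans x1 x2; rewrite ltxx.
  by have := lt_le_trans b23 (le_trans x2 x1); rewrite ltxx.
  by apply: measurableU; exact: measurable_itv.
congr (integral _ _ _); apply/seteqP; split => [x /=|x /=]; rewrite !in_itv/=.
  move=> /andP[x1 x2].
  have [xb2|xb2] := leP x b2; first by left; rewrite x1.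
  by right; have [xb3|xb3] := ltP x b3; [left|right; rewrite x2].
by case=> [/andP[x1 x2]|[/andP[x1 x2]|/andP[x1 x2]]]; apply/andP; split; lra.
Qed.

Lemma integral_continuous (a b : R) f : continuous f ->
  (\int[mu]_(x in `[a, b]) (f x)%:E = (\int[mu]_(x in `[a, b]) f x)%R%:E)%E.
Proof.
move=> cf; rewrite /Rintegral fineK//.
by apply: integrable_fin_num => //; apply: continuous_integrable_itv => x _; exact: cf.
Qed.

Lemma integral_support (L : R) (h : R -> \bar R) :
  (forall x, ~~ (- (L / 2) < x < L / 2) -> h x = 0%E) ->
  (\int[mu]_x h x = \int[mu]_(x in `[(- (L / 2))%R, (L / 2)%R]) h x)%E.
Proof.
move=> h0; rewrite [RHS]integral_mkcond; congr (integral _ _ _).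
apply/funext => x; rewrite /patch; case: ifPn => // xL.
apply: h0; apply: contra xL => /andP[x1 x2]; rewrite inE/= in_itv/=.
by rewrite !ltW.
Qed.

Lemma slice_friedrichs_ereal (L theta : R) f df : 0 < L -> 0 < theta < 1 ->
  (forall x, is_derive x (1 : R) f (df x)) -> continuous df ->
  (forall x, ~~ (- (L / 2) < x < L / 2) -> f x = 0) ->
  (\int[mu]_x ((pi * theta / L) ^+ 2 * f x ^+ 2)%:E <= \int[mu]_x (df x ^+ 2)%:E)%E.
Proof.
move=> L0 tt fdf cdf f0.
have cf : continuous f by move=> x; exact: is_derive_continuous (fdf x).
have cdf2 : continuous (fun x => df x ^+ 2) by move=> x; apply: cvgM; exact: cdf.
have cf2 : continuous (fun x => (pi * theta / L) ^+ 2 * f x ^+ 2).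
  by move=> x; apply: cvgM; [exact: cvg_cst|apply: cvgM; exact: cf].
rewrite (@integral_support L); last by move=> x /f0 ->; rewrite expr0n/= mulr0.
apply: (@le_trans _ _ (\int[mu]_(x in `[(- (L / 2))%R, (L / 2)%R]) (df x ^+ 2)%:E)%E); last first.
  apply: ge0_subset_integral => //.
    by apply/measurable_EFinP; exact: continuous_measurable_fun.
  by move=> x _; rewrite lee_fin sqr_ge0.
rewrite !integral_continuous// lee_fin RintegralZl//; last first.
  by apply: continuous_integrable_itv => x _; apply: cvgM; exact: cf.
by apply: slice_friedrichs => //; apply: f0; rewrite ltxx ?andbF.
Qed.

Lemma slice_strip_ereal (L delta gamma theta : R) f df w :
  let k := 2 * pi * theta / L in
  let tau := k * tan (pi * theta / 2) in
  0 < L -> 0 < theta < 1 -> 0 < delta -> delta < L / 2 -> 0 <= gamma ->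
  tau / delta + tau ^+ 2 <= gamma - k ^+ 2 ->
  measurable_fun [set: measurableTypeR R] w ->
  (forall x, 0 <= w x) -> (forall x, - delta < x < delta -> gamma <= w x) ->
  (forall x, is_derive x (1 : R) f (df x)) -> continuous df ->
  (forall x, ~~ (- (L / 2) < x < L / 2) -> f x = 0) ->
  (\int[mu]_x (k ^+ 2 * f x ^+ 2)%:E <=
   \int[mu]_x (df x ^+ 2 + w x * f x ^+ 2)%:E)%E.
Proof.
move=> k tau L0 tt d0 dL g0 taug mw w0 wg fdf cdf f0.
have cf : continuous f by move=> x; exact: is_derive_continuous (fdf x).
have cdf2 : continuous (fun x => df x ^+ 2) by move=> x; apply: cvgM; exact: cdf.
have cf2 (c : R) : continuous (fun x => c * f x ^+ 2).
  by move=> x; apply: cvgM; [exact: cvg_cst|apply: cvgM; exact: cf].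
have cfg : continuous (fun x => df x ^+ 2 + gamma * f x ^+ 2).
  by move=> x; apply: cvgD; [exact: cdf2|exact: cf2].
have mf : measurable_fun [set: measurableTypeR R] f by exact: continuous_measurable_fun.
have mrhs : measurable_fun [set: measurableTypeR R] (fun x => (df x ^+ 2 + w x * f x ^+ 2)%:E).
  apply/measurable_EFinP; apply: measurable_funD.
    exact: continuous_measurable_fun.
  by apply: measurable_funM => //; exact: measurable_funX.
have rhs0 x : (0 <= (df x ^+ 2 + w x * f x ^+ 2)%:E)%E.
  by rewrite lee_fin addr_ge0 ?sqr_ge0// mulr_ge0 ?sqr_ge0.
rewrite (@integral_support L); last by move=> x /f0 ->; rewrite expr0n/= mulr0.
apply: (@le_trans _ _ (\int[mu]_(x in `[(- (L / 2))%R, (L / 2)%R])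
    (df x ^+ 2 + w x * f x ^+ 2)%:E)%E); last first.
  by apply: ge0_subset_integral => //; exact: mrhs.
have l1 : - (L / 2) < - delta by lra.
have l2 : - delta < delta by lra.
rewrite !(integral_cover3 l1 l2 dL)//; last 2 first.
- by apply/measurable_EFinP; exact: continuous_measurable_fun.
- by move=> x; rewrite lee_fin mulr_ge0 ?sqr_ge0.
have mrS (D : set (measurableTypeR R)) :
    measurable_fun D (fun x => (df x ^+ 2 + w x * f x ^+ 2)%:E).
  exact: measurable_funTS.
have side a b : ((\int[mu]_(x in `[a, b]) df x ^+ 2)%R%:E <=
    \int[mu]_(x in `[a, b]) (df x ^+ 2 + w x * f x ^+ 2)%:E)%E.
  rewrite -integral_continuous//; apply: ge0_le_integral => //.
  - by move=> x _; rewrite lee_fin sqr_ge0.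
  - by apply/measurable_EFinP/measurable_funTS; exact: continuous_measurable_fun.
  - by move=> x _; rewrite lee_fin lerDl mulr_ge0 ?sqr_ge0.
have middle : ((\int[mu]_(x in `[(- delta)%R, delta]) (df x ^+ 2 + gamma * f x ^+ 2))%R%:E <=
    \int[mu]_(x in `[(- delta)%R, delta]) (df x ^+ 2 + w x * f x ^+ 2)%:E)%E.
  rewrite -integral_continuous//.
  have mg (D : set (measurableTypeR R)) :
      measurable_fun D (fun x => (df x ^+ 2 + gamma * f x ^+ 2)%:E).
    by apply/measurable_EFinP/measurable_funTS; exact: continuous_measurable_fun.
  rewrite -(integral_itv_obnd_cbnd (mg [set` `](- delta)%R, delta]])).
  rewrite -(integral_itv_bndo_bndc (mg [set` `](- delta)%R, delta[])).
  rewrite -(integral_itv_obnd_cbnd (mrS [set` `](- delta)%R, delta]])).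
  rewrite -(integral_itv_bndo_bndc (mrS [set` `](- delta)%R, delta[])).
  apply: ge0_le_integral => //.
  - by move=> x _; rewrite lee_fin addr_ge0 ?sqr_ge0// mulr_ge0 ?sqr_ge0.
  - move=> x; rewrite /= in_itv/= => xd.
    by rewrite lee_fin lerD2l ler_wpM2r ?sqr_ge0// wg.
apply: (le_trans _ (leeD (side _ _) (leeD middle (side _ _)))).
rewrite !integral_continuous// -!EFinD lee_fin Rintegral_energy//.
have I (a b : R) : mu.-integrable `[a, b] (EFin \o (fun x => f x ^+ 2)).
  by apply: continuous_integrable_itv => x _; apply: cvgM; exact: cf.
rewrite !RintegralZl// addrA [leRHS]addrA.
by apply: slice_strip => //; apply: f0; rewrite ltxx ?andbF.
Qed.

End Tonelli.

(** * Energy lower bound for test functions *)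

Section EnergyLowerBound.
Context {R : realType}.
Implicit Types (phi : R * R -> R).

Local Notation mu := (@lebesgue_measure R).

(** A directional derivative is the ordinary derivative along a line. *)
Lemma derivable_slice (g : R -> R) phi (z : R * R) (v : R * R) (x : R) :
  (forall h : R, phi (h *: v + z) = g (h + x)) -> derivable phi z v ->
  is_derive x (1 : R) g ('D_v phi z).
Proof.
move=> phig dphi.
have E : (fun h : R => h^-1 *: (g (h *: (1 : R) + x) - g x)) =
         (fun h => h^-1 *: (phi (h *: v + z) - phi z)).
  apply/funext => h; rewrite phig -[X in phi X]add0r -[X in phi (X + _)](scale0r v).
  by rewrite phig add0r [h *: 1]mulr1.
split; first by rewrite /derivable/= E.
by rewrite /derive/= E.
Qed.

Lemma is_derive_slice0 phi (x y : R) : smooth phi ->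
  is_derive x (1 : R) (fun t => phi (t, y)) (partial ord0 phi (x, y)).
Proof.
move=> sphi; apply: derivable_slice; last exact: smooth_derivable.
move=> h; congr phi; rewrite [LHS]surjective_pairing.
by congr pair; rewrite /= /GRing.scale /= ?mulr1 ?mulr0 ?add0r.
Qed.

Lemma is_derive_slice1 phi (x y : R) : smooth phi ->
  is_derive y (1 : R) (fun t => phi (x, t)) (partial ord_max phi (x, y)).
Proof.
move=> sphi; apply: derivable_slice; last exact: smooth_derivable.
move=> h; congr phi; rewrite [LHS]surjective_pairing.
by congr pair; rewrite /= /GRing.scale /= ?mulr1 ?mulr0 ?add0r.
Qed.

Lemma continuous_slice0 phi (y : R) : continuous phi -> continuous (fun t => phi (t, y)).
Proof.
move=> cphi x; apply: (@continuous_comp _ _ _ (fun t => (t, y)) phi); last exact: cphi.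
move=> A /= HA.
by have := @cvg_pair _ _ _ (nbhs x) _ _ _ _ _ _ _ cvg_id (cvg_cst y); exact.
Qed.

Lemma continuous_slice1 phi (x : R) : continuous phi -> continuous (fun t => phi (x, t)).
Proof.
move=> cphi y; apply: (@continuous_comp _ _ _ (fun t => (x, t)) phi); last exact: cphi.
move=> A /= HA.
by have := @cvg_pair _ _ _ (nbhs y) _ _ _ _ _ _ _ (cvg_cst x) cvg_id; exact.
Qed.

Lemma inner_supported (L : R) (f g : plane R -> R) :
  L2 (square L) f -> L2 (square L) g ->
  (forall z, ~ square L z -> f z = 0) ->
  ((inner (square L) f g)%:E = \int[lebesgue2]_z (f z * g z)%:E)%E.
Proof.
move=> Lf Lg f0; rewrite innerE /Rintegral fineK; last first.
  by apply: integrable_fin_num => //; exact: L2_integrable.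
apply: eq_integral => z _; rewrite /patch; case: ifPn => // nz.
by rewrite (f0 z) ?mul0r// => sz; rewrite mem_set in nz.
Qed.

Lemma slice_outside (L x y : R) phi : test_function (square L) phi ->
  ~~ (- (L / 2) < x < L / 2) \/ ~~ (- (L / 2) < y < L / 2) -> phi (x, y) = 0.
Proof.
move=> tphi xy; apply: test_function_eq0 tphi _ => -[]; rewrite /= !in_itv/=.
by case: xy => /negP.
Qed.

(** Tonelli's theorem and monotonicity of the integral in the other variable. *)
Lemma le_tonelli_x (f g : plane R -> R) :
  measurable_fun setT f -> measurable_fun setT g ->
  (forall z, 0 <= f z) -> (forall z, 0 <= g z) ->
  (forall y, (\int[mu]_x (f (x, y))%:E <= \int[mu]_x (g (x, y))%:E)%E) ->
  (\int[lebesgue2]_z (f z)%:E <= \int[lebesgue2]_z (g z)%:E)%E.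
Proof.
move=> mf mg f0 g0 fg.
have mf' : measurable_fun setT (EFin \o f) by exact/measurable_EFinP.
have mg' : measurable_fun setT (EFin \o g) by exact/measurable_EFinP.
have f0' z : (0 <= (EFin \o f) z)%E by rewrite lee_fin.
have g0' z : (0 <= (EFin \o g) z)%E by rewrite lee_fin.
rewrite /lebesgue2 (fubini_tonelli2 _ mf' f0') (fubini_tonelli2 _ mg' g0').
apply: ge0_le_integral => //.
- by move=> y _; exact: integral_ge0.
- exact: measurable_fun_fubini_tonelli_G.
- exact: measurable_fun_fubini_tonelli_G.
- by move=> t _; exact: fg.
Qed.

Lemma le_tonelli_y (f g : plane R -> R) :
  measurable_fun setT f -> measurable_fun setT g ->
  (forall z, 0 <= f z) -> (forall z, 0 <= g z) ->
  (forall x, (\int[mu]_y (f (x, y))%:E <= \int[mu]_y (g (x, y))%:E)%E) ->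
  (\int[lebesgue2]_z (f z)%:E <= \int[lebesgue2]_z (g z)%:E)%E.
Proof.
move=> mf mg f0 g0 fg.
have mf' : measurable_fun setT (EFin \o f) by exact/measurable_EFinP.
have mg' : measurable_fun setT (EFin \o g) by exact/measurable_EFinP.
have f0' z : (0 <= (EFin \o f) z)%E by rewrite lee_fin.
have g0' z : (0 <= (EFin \o g) z)%E by rewrite lee_fin.
rewrite /lebesgue2 (fubini_tonelli1 _ mf' f0') (fubini_tonelli1 _ mg' g0').
apply: ge0_le_integral => //.
- by move=> y _; exact: integral_ge0.
- exact: measurable_fun_fubini_tonelli_F.
- exact: measurable_fun_fubini_tonelli_F.
- by move=> t _; exact: fg.
Qed.

(** The potential is used here, in the x direction only, where the strip splits
    each slice in two. *)
Lemma energy_x_lower_bound (L delta gamma theta M : R) (w : plane R -> R) phi :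
  let k := 2 * pi * theta / L in
  let tau := k * tan (pi * theta / 2) in
  0 < L -> 0 < theta < 1 -> 0 < delta -> delta < L / 2 -> 0 <= gamma ->
  tau / delta + tau ^+ 2 <= gamma - k ^+ 2 ->
  measurable_fun setT w -> (forall z, 0 <= w z <= M) ->
  (forall x y, - delta < x < delta -> gamma <= w (x, y)) ->
  test_function (square L) phi ->
  k ^+ 2 * inner (square L) phi phi <=
  inner (square L) (partial ord0 phi) (partial ord0 phi) +
  inner (square L) (w \* phi) phi.
Proof.
move=> k tau L0 tt d0 dL g0 taug mw w0M wg tphi.
have [sphi _ _] := tphi.
have tdphi := test_function_partial ord0 tphi.
have cphi := smooth_continuous sphi.
have cdphi : continuous (partial ord0 phi) by case: tdphi => /smooth_continuous.
have mphi := continuous_measurable_plane cphi.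
have mdphi := continuous_measurable_plane cdphi.
have Lphi := test_function_L2 tphi.
have Ldphi := test_function_L2 tdphi.
have Lwphi := L2_mul mw w0M Lphi.
have phi0 z : ~ square L z -> phi z = 0 by exact: test_function_eq0.
have dphi0 z : ~ square L z -> partial ord0 phi z = 0 by exact: test_function_eq0.
have wphi0 z : ~ square L z -> (w \* phi) z = 0 by move=> /phi0 /= ->; rewrite mulr0.
have w0 z : 0 <= w z by have /andP[] := w0M z.
rewrite -lee_fin EFinM EFinD !inner_supported//.
rewrite -ge0_integralZl_EFin ?sqr_ge0//; last 2 first.
- by move=> z _; rewrite lee_fin -expr2 sqr_ge0.
- by apply/measurable_EFinP; exact: measurable_funM.
rewrite -ge0_integralD//; last 4 first.
- by move=> z _; rewrite lee_fin -expr2 sqr_ge0.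
- by apply/measurable_EFinP; exact: measurable_funM.
- by move=> z _; rewrite lee_fin /= -mulrA -expr2 mulr_ge0 ?sqr_ge0.
- by apply/measurable_EFinP; apply: measurable_funM => //; exact: measurable_funM.
have E1 : (\int[lebesgue2]_z ((k ^+ 2)%:E * (phi z * phi z)%:E) =
    \int[lebesgue2]_z (k ^+ 2 * phi z ^+ 2)%R%:E)%E.
  by apply: eq_integral => z _; rewrite -EFinM expr2.
have E2 : (\int[lebesgue2]_z ((partial ord0 phi z * partial ord0 phi z)%:E +
     ((w \* phi) z * phi z)%:E) =
    \int[lebesgue2]_z (partial ord0 phi z ^+ 2 + w z * phi z ^+ 2)%R%:E)%E.
  by apply: eq_integral => z _; rewrite -EFinD -!expr2 /= -mulrA -expr2.
rewrite E1 E2; apply: le_tonelli_x.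
- by apply: measurable_funM => //; exact: measurable_funX.
- apply: measurable_funD; first exact: measurable_funX.
  by apply: measurable_funM => //; exact: measurable_funX.
- by move=> z; rewrite mulr_ge0 ?sqr_ge0.
- by move=> z; rewrite addr_ge0 ?sqr_ge0// mulr_ge0 ?sqr_ge0.
move=> y.
apply: (@slice_strip_ereal R L delta gamma theta (fun x => phi (x, y))
  (fun x => partial ord0 phi (x, y)) (fun x => w (x, y))) => //.
- exact: measurable_fun_pair1.
- by move=> x; exact: wg.
- by move=> x; exact: is_derive_slice0.
- exact: continuous_slice0.
- by move=> x xL; apply: slice_outside tphi _; left.
Qed.

Lemma energy_y_lower_bound (L theta : R) phi :
  0 < L -> 0 < theta < 1 ->
  test_function (square L) phi ->
  (pi * theta / L) ^+ 2 * inner (square L) phi phi <=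
  inner (square L) (partial ord_max phi) (partial ord_max phi).
Proof.
move=> L0 tt tphi; set k := pi * theta / L.
have [sphi _ _] := tphi.
have tdphi := test_function_partial ord_max tphi.
have cphi := smooth_continuous sphi.
have cdphi : continuous (partial ord_max phi) by case: tdphi => /smooth_continuous.
have mphi := continuous_measurable_plane cphi.
have mdphi := continuous_measurable_plane cdphi.
have Lphi := test_function_L2 tphi.
have Ldphi := test_function_L2 tdphi.
have phi0 z : ~ square L z -> phi z = 0 by exact: test_function_eq0.
have dphi0 z : ~ square L z -> partial ord_max phi z = 0 by exact: test_function_eq0.
rewrite -lee_fin EFinM !inner_supported//.
rewrite -ge0_integralZl_EFin ?sqr_ge0//; last 2 first.
- by move=> z _; rewrite lee_fin -expr2 sqr_ge0.
- by apply/measurable_EFinP; exact: measurable_funM.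
have E1 : (\int[lebesgue2]_z ((k ^+ 2)%:E * (phi z * phi z)%:E) =
    \int[lebesgue2]_z (k ^+ 2 * phi z ^+ 2)%R%:E)%E.
  by apply: eq_integral => z _; rewrite -EFinM expr2.
have E2 : (\int[lebesgue2]_z (partial ord_max phi z * partial ord_max phi z)%:E =
    \int[lebesgue2]_z (partial ord_max phi z ^+ 2)%R%:E)%E.
  by apply: eq_integral => z _; rewrite -expr2.
rewrite E1 E2; apply: le_tonelli_y.
- by apply: measurable_funM => //; exact: measurable_funX.
- exact: measurable_funX.
- by move=> z; rewrite mulr_ge0 ?sqr_ge0.
- by move=> z; rewrite sqr_ge0.
move=> x.
apply: (@slice_friedrichs_ereal R L theta (fun y => phi (x, y))
  (fun y => partial ord_max phi (x, y))) => //.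
- by move=> y; exact: is_derive_slice1.
- exact: continuous_slice1.
- by move=> y yL; apply: slice_outside tphi _; right.
Qed.

End EnergyLowerBound.

(** * Weak equation of an eigenfunction and lower bound for its eigenvalue *)

Section Eigenfunctions.
Context {R : realType}.
Implicit Types (Omega : set (plane R)) (f g u psi w phi : plane R -> R).

Lemma sum_axes (F : 'I_2 -> R) : \sum_(i < 2) F i = F ord0 + F ord_max.
Proof.
rewrite big_ord_recl big_ord_recl big_ord0 addr0; congr (_ + F _).
exact: val_inj.
Qed.

Lemma inner_mul_le (L M : R) w f : measurable_fun setT w -> (forall z, 0 <= w z <= M) ->
  L2 (square L) f ->
  inner (square L) (w \* f) (w \* f) <= M ^+ 2 * inner (square L) f f.
Proof.
move=> mw wM Lf; have Lwf := L2_mul mw wM Lf.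
rewrite !innerE -RintegralZl//; last exact: L2_integrable.
apply: le_Rintegral => //; first exact: L2_integrable.
  exact: (integrableZl measurableT (M ^+ 2) (L2_integrable Lf Lf)).
move=> z _; rewrite -!expr2 /patch; case: ifP => _ /=; last by rewrite expr0n mulr0.
have /andP[w0 wMz] := wM z.
by rewrite exprMn ler_wpM2r ?sqr_ge0// ler_pXn2r// nnegrE (le_trans w0).
Qed.

Lemma inner_mulC Omega w f g : inner Omega (w \* f) g = inner Omega f (w \* g).
Proof. by apply: eq_Rintegral => z _ /=; rewrite [RHS]mulrCA mulrA. Qed.

Lemma inner_ae (L : R) f g h :
  L2 (square L) f -> L2 (square L) g -> L2 (square L) h ->
  {ae lebesgue2, forall z, square L z -> f z = g z} ->
  inner (square L) f h = inner (square L) g h.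
Proof.
move=> Lf Lg Lh fg; rewrite !innerE /Rintegral; congr fine.
have mfh := measurable_int _ (L2_integrable Lf Lh).
have mgh := measurable_int _ (L2_integrable Lg Lh).
apply: ae_eq_integral => //.
apply: filterS fg => z fgz _; rewrite /patch.
by case: ifPn => // /[!inE] /fgz ->.
Qed.

(** Only the definition of the weak derivatives is used, twice, so that all
    derivatives fall on the test function. *)
Lemma schrodinger_weak (L M lam : R) w psi phi :
  measurable_fun setT w -> (forall z, 0 <= w z <= M) ->
  schrodinger w L psi (fun z => lam * psi z) ->
  test_function (square L) phi ->
  lam * inner (square L) psi phi =
  - (inner (square L) psi (partial ord0 (partial ord0 phi)) +
     inner (square L) psi (partial ord_max (partial ord_max phi))) +
  inner (square L) (w \* psi) phi.
Proof.
move=> mw wM [[Lpsi _] _ [d dP ae]] tphi.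
have Lphi := test_function_L2 tphi.
have Ld i : L2 (square L) (d i) by have [g _ []] := dP i.
have dE i : inner (square L) (d i) phi = inner (square L) psi (partial i (partial i phi)).
  have [g [_ _ ug] [_ _ gd]] := dP i.
  by rewrite (ug _ (test_function_partial i tphi)) gd// opprK.
have Lwpsi := L2_mul mw wM Lpsi.
have Lsum : L2 (square L) (fun z => -1 * (d ord0 \+ d ord_max) z + 1 * (w \* psi) z).
  by apply: L2_comb => //; apply: L2D.
have Llam : L2 (square L) (fun z => lam * psi z + 0 * psi z) by exact: L2_comb.
transitivity (inner (square L) (fun z => lam * psi z + 0 * psi z) phi).
  by rewrite inner_combl// mul0r addr0.
rewrite (inner_ae Llam Lsum Lphi); last first.
  apply: filterS ae => z H /H; rewrite sum_axes /= => lE.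
  by rewrite lE mul0r addr0 mulN1r mul1r.
by rewrite inner_combl//; [rewrite innerDl// !dE mulN1r mul1r|exact: L2D].
Qed.

(** The same equation with a single derivative on the test function, for any
    choice of the weak gradient of the eigenfunction: the gradient by which
    [H10] approximates it need not be the one that appears in the equation. *)
Lemma schrodinger_form (L M lam : R) w psi (g : 'I_2 -> plane R -> R) phi :
  measurable_fun setT w -> (forall z, 0 <= w z <= M) ->
  schrodinger w L psi (fun z => lam * psi z) ->
  (forall i, weak_partial (square L) i psi (g i)) ->
  test_function (square L) phi ->
  lam * inner (square L) psi phi =
  inner (square L) (g ord0) (partial ord0 phi) +
  inner (square L) (g ord_max) (partial ord_max phi) +
  inner (square L) (w \* psi) phi.
Proof.
move=> mw wM sch gP tphi; rewrite (schrodinger_weak mw wM sch tphi).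
have [_ _ g0] := gP ord0; have [_ _ g1] := gP ord_max.
have arith (a b x y t : R) : a = - x -> b = - y -> - (a + b) + t = x + y + t.
  by move=> -> ->; rewrite opprD !opprK.
exact: arith (g0 _ (test_function_partial ord0 tphi))
  (g1 _ (test_function_partial ord_max tphi)).
Qed.

Lemma inner_le Omega f g (A B : R) : L2 Omega f -> L2 Omega g -> 0 <= A -> 0 <= B ->
  inner Omega f f <= A ^+ 2 -> inner Omega g g <= B ^+ 2 ->
  `|inner Omega f g| <= A * B.
Proof.
move=> Lf Lg A0 B0 fA gB; rewrite -(@ler_pXn2r _ 2)// ?nnegrE ?mulr_ge0//.
rewrite real_normK ?num_real// (le_trans (Cauchy_Schwarz Lf Lg))// exprMn.
by apply: ler_pM => //; exact: inner_ge0.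
Qed.

(** A triangle inequality: a function e-close to one of norm at most A has norm
    at most A + e. *)
Lemma inner_sub_le Omega f g (A e : R) : L2 Omega f -> L2 Omega g -> 0 <= A -> 0 <= e ->
  inner Omega f f <= A ^+ 2 -> inner Omega (f \- g) (f \- g) <= e ^+ 2 ->
  inner Omega g g <= (A + e) ^+ 2.
Proof.
move=> Lf Lg A0 e0 fA fge; have Lr := L2B Lf Lg.
have /ler_normlP[h1 h2] := inner_le Lf Lr A0 e0 fA fge.
have E : inner Omega g g =
    inner Omega f f - 2 * inner Omega f (f \- g) + inner Omega (f \- g) (f \- g).
  by rewrite !innerBl// !innerBr// (innerC _ g f); ring.
by rewrite E; nra.
Qed.

(** The estimate of [eigenvalue_lower_bound] with the inner products replaced by
    real numbers.  With psi the eigenfunction, g its gradient and phi a test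
    function e-close to psi in H^1, the letters stand for P = (phi, phi),
    a = (g, d phi), d = (d phi, d phi), x = (g - d phi, d phi),
    u1 = (w psi, phi), u2 = (w phi, phi), y = u1 - u2, s = sp = (psi, phi),
    b = (psi - phi, phi), t = (psi - phi, psi), q = (psi - phi, psi - phi) and
    pp = (psi, psi).  The energy bound for phi and the weak equation
    bound (c - lam) P by a multiple of e, while P >= 1 - 2 e. *)
Lemma approximate_ground_state_estimate
    (c lam e M n0 n1 P a0 a1 d0 d1 u1 u2 s x0 x1 y b q t pp sp : R) :
  0 < e -> e <= 4^-1 -> lam <= c -> 0 <= M -> 0 <= n0 -> 0 <= n1 ->
  pp = 1 -> lam * s = a0 + a1 + u1 ->
  x0 = a0 - d0 -> x1 = a1 - d1 -> y = u1 - u2 -> b = s - P -> q = t - b ->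
  t = pp - sp -> s = sp ->
  `|x0| <= e * (n0 + e) -> `|x1| <= e * (n1 + e) -> `|y| <= M * e * (1 + e) ->
  `|t| <= e * 1 -> lam * b <= `|lam| * (e * (1 + e)) ->
  c * P <= d0 + d1 + u2 -> 0 <= q ->
  (c - lam) / 2 <= e * (n0 + n1 + 2 + 2 * M + 2 * `|lam|).
Proof.
move=> e0 e4 lamc M0 n00 n10 -> weak X0 X1 Y B Q T S hx0 hx1 hy ht hb cP q0.
move: hx0 hx1 hy ht; rewrite !ler_norml.
move=> /andP[hx0 _] /andP[hx1 _] /andP[hy _] /andP[_ ht].
have P1 : 1 - 2 * e <= P by lra.
have l0 := normr_ge0 lam; set l := `|lam| in hb l0 *.
have e1 : e <= 1 by lra.
have ee : e * e <= e by rewrite ger_pMr.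
have Me : M * (e * e) <= M * e by rewrite ler_wpM2l.
have le' : l * (e * e) <= l * e by rewrite ler_wpM2l.
have up : (c - lam) * P <= e * (n0 + n1 + 2 + 2 * M + 2 * l) by nra.
have cl : 0 <= c - lam by lra.
have : (c - lam) * 2^-1 <= (c - lam) * P by rewrite ler_wpM2l//; lra.
lra.
Qed.

(** A lower bound of the energy on test functions passes to eigenfunctions:
    test a normalized eigenfunction against its own approximations. *)
Lemma eigenvalue_lower_bound (L M lam c : R) w psi :
  measurable_fun setT w -> (forall z, 0 <= w z <= M) ->
  schrodinger w L psi (fun z => lam * psi z) ->
  inner (square L) psi psi = 1 ->
  (forall phi, test_function (square L) phi ->
    c * inner (square L) phi phi <=
    inner (square L) (partial ord0 phi) (partial ord0 phi) +
    inner (square L) (partial ord_max phi) (partial ord_max phi) +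
    inner (square L) (w \* phi) phi) ->
  c <= lam.
Proof.
move=> mw wM sch psi1 cP.
have [[Lpsi [g gP app]] _ _] := sch.
have M0 : 0 <= M by have /andP[] := wM (0, 0); exact: le_trans.
have Lg i : L2 (square L) (g i) by have [] := gP i.
pose N i : R := Num.sqrt (inner (square L) (g i) (g i)).
have NE i : inner (square L) (g i) (g i) <= N i ^+ 2.
  by rewrite /N sqr_sqrtr// inner_ge0.
have N0 i : 0 <= N i by exact: sqrtr_ge0.
(* for e <= 1/4 the error terms add up to at most e * K *)
pose K := N ord0 + N ord_max + 2 + 2 * M + 2 * `|lam|.
have key (e : R) : 0 < e -> e <= 4^-1 -> lam <= c -> (c - lam) / 2 <= e * K.
  move=> e0 e4 lamc; have [phi tphi [phie dphie]] := app e e0.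
  have tdphi i := test_function_partial i tphi.
  have Lphi := test_function_L2 tphi.
  have Ldphi i := test_function_L2 (tdphi i).
  have e0' := ltW e0.
  have Lr : L2 (square L) (psi \- phi) by exact: L2B.
  have Lri i : L2 (square L) (g i \- partial i phi) by exact: L2B.
  have rr := ltW (norm2_lt Lr e0 phie).
  have rri i := ltW (norm2_lt (Lri i) e0 (dphie i)).
  have psi1' : inner (square L) psi psi <= 1 ^+ 2 by rewrite psi1 expr1n.
  have phi1 := inner_sub_le Lpsi Lphi ler01 e0' psi1' rr.
  have dphi1 i := inner_sub_le (Lg i) (Ldphi i) (N0 i) e0' (NE i) (rri i).
  have weak := schrodinger_form mw wM sch gP tphi.
  have D0 := innerBl (Lg ord0) (Ldphi ord0) (Ldphi ord0).
  have D1 := innerBl (Lg ord_max) (Ldphi ord_max) (Ldphi ord_max).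
  have Lwpsi := L2_mul mw wM Lpsi.
  have Lwphi := L2_mul mw wM Lphi.
  have Lwr := L2_mul mw wM Lr.
  have W : inner (square L) (w \* (psi \- phi)) phi =
      inner (square L) (w \* psi) phi - inner (square L) (w \* phi) phi.
    rewrite -innerBl//; congr inner.
    by apply/funext => z /=; rewrite mulrBr.
  have S := innerBl Lpsi Lphi Lphi.
  have P := innerBr Lpsi Lphi Lpsi.
  have Q := innerBr Lpsi Lphi Lr.
  have RR := innerBl Lpsi Lphi Lpsi.
  have B0 := inner_le (Lri ord0) (Ldphi ord0) e0' (addr_ge0 (N0 ord0) e0')
    (rri ord0) (dphi1 ord0).
  have B1 := inner_le (Lri ord_max) (Ldphi ord_max) e0' (addr_ge0 (N0 ord_max) e0')
    (rri ord_max) (dphi1 ord_max).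
  have rw : inner (square L) (w \* (psi \- phi)) (w \* (psi \- phi)) <= (M * e) ^+ 2.
    apply: (le_trans (inner_mul_le mw wM Lr)).
    by rewrite exprMn ler_wpM2l// sqr_ge0.
  have B2 := inner_le Lwr Lphi (mulr_ge0 M0 e0') (addr_ge0 ler01 e0') rw phi1.
  have B3 := inner_le Lr Lphi e0' (addr_ge0 ler01 e0') rr phi1.
  have B4 := inner_le Lr Lpsi e0' ler01 rr psi1'.
  have B5 : lam * inner (square L) (psi \- phi) phi <= `|lam| * (e * (1 + e)).
    apply: le_trans (ler_norm _) _; rewrite normrM ler_wpM2l//.
  have cphi := cP _ tphi.
  have r0 := inner_ge0 (square L) (psi \- phi).
  have sym := innerC (square L) psi phi.
  exact: (approximate_ground_state_estimate e0 e4 lamc M0 (N0 ord0) (N0 ord_max)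
    psi1 weak D0 D1 W S Q RR sym B0 B1 B2 B4 B5 cphi r0).
rewrite leNgt; apply/negP => lamc.
have K0 : 2 <= K.
  by rewrite /K; have := normr_ge0 lam; have := N0 ord0; have := N0 ord_max; lra.
have cl : 0 < c - lam by rewrite subr_gt0.
pose e := Num.min 4^-1 ((c - lam) / (4 * K)).
have e0 : 0 < e by rewrite lt_min invr_gt0 ltr0n/= divr_gt0// mulr_gt0//; lra.
have e4 : e <= 4^-1 by rewrite ge_min lexx.
have eK : e * K <= (c - lam) / 4.
  have : e <= (c - lam) / (4 * K) by rewrite ge_min lexx orbT.
  have -> : (c - lam) / 4 = (c - lam) / (4 * K) * K by field; lra.
  by move=> h; apply: ler_wpM2r => //; lra.
have := key e e0 e4 (ltW lamc); lra.
Qed.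

End Eigenfunctions.

(** * Expansion in eigenfunctions and upper bound for the second eigenvalue *)

Section Spectral.
Context {R : realType}.
Implicit Types (Omega : set (plane R)) (f g h : plane R -> R) (psi : nat -> plane R -> R).

Lemma L2_cst0 Omega f : L2 Omega f -> L2 Omega (fun=> 0).
Proof.
move=> Lf; have := L2_comb 0 0 Lf Lf; congr (L2 _ _).
by apply/funext => z; rewrite !mul0r addr0.
Qed.

Lemma L2_partial_sum Omega psi (c : nat -> R) n : (forall k, L2 Omega (psi k)) ->
  L2 Omega (fun z => \sum_(k < n) c k * psi k z).
Proof.
move=> Lpsi; elim: n => [|n IHn].
  have := L2_cst0 (Lpsi 0%N); congr (L2 _ _).
  by apply/funext => z; rewrite big_ord0.
have := L2_comb 1 (c n) IHn (Lpsi n); congr (L2 _ _).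
by apply/funext => z; rewrite big_ord_recr/= mul1r.
Qed.

Lemma inner_partial_sum Omega psi (c : nat -> R) n f :
  (forall k, L2 Omega (psi k)) -> L2 Omega f ->
  inner Omega f (fun z => \sum_(k < n) c k * psi k z) =
  \sum_(k < n) c k * inner Omega f (psi k).
Proof.
move=> Lpsi Lf; elim: n => [|n IHn].
  have Ls0 := L2_partial_sum c 0 Lpsi.
  rewrite [RHS]big_ord0 -[RHS](subrr (inner Omega f (fun z => \sum_(k < 0) c k * psi k z))) -innerBr//.
  by apply: eq_Rintegral => z _ /=; rewrite subrr big_ord0.
rewrite big_ord_recr/= -IHn -[X in X + _]mul1r -inner_combr//; last first.
  exact: L2_partial_sum.
by apply: eq_Rintegral => z _; rewrite big_ord_recr/= mul1r.
Qed.

(** Here h stands for the operator applied to f.  With c_k the coefficients of f,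
    (h - lam_1 f, f) is the limit of the sums of (lam_k - lam_1) c_k^2, in which
    the term k = 0 vanishes and the others are nonnegative. *)
Lemma second_eigenvalue_le_form Omega psi (lam : nat -> R) f h :
  hilbert_basis Omega psi -> {homo lam : j k / (j <= k)%N >-> j <= k} ->
  L2 Omega f -> L2 Omega h ->
  (forall k, inner Omega h (psi k) = lam k * inner Omega f (psi k)) ->
  inner Omega f (psi 0%N) = 0 ->
  lam 1%N * inner Omega f f <= inner Omega h f.
Proof.
move=> [Lpsi _ complete] lam_le Lf Lh hf f0.
pose c k := inner Omega f (psi k).
pose q z := 1 * h z + (- lam 1%N) * f z.
have Lq : L2 Omega q by exact: L2_comb.
have qf : inner Omega q f = inner Omega h f - lam 1%N * inner Omega f f.
  by rewrite inner_combl// mul1r mulNr.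
rewrite -subr_ge0 -qf.
have qs n : 0 <= inner Omega q (fun z => \sum_(k < n) c k * psi k z).
  rewrite inner_partial_sum//; apply: sumr_ge0 => k _.
  rewrite inner_combl// hf mul1r -mulrDl mulrCA -expr2.
  case: k => -[|k] kn /=; first by rewrite /c f0 expr0n mulr0.
  by rewrite mulr_ge0 ?sqr_ge0// subr_ge0; exact: lam_le.
rewrite leNgt; apply/negP => qf0.
pose A := Num.sqrt (inner Omega q q) + 1.
have A1 : 1 <= A by rewrite lerDr sqrtr_ge0.
have qA : inner Omega q q <= A ^+ 2.
  rewrite -[X in X <= _]sqr_sqrtr ?inner_ge0//.
  by rewrite ler_pXn2r ?nnegrE ?sqrtr_ge0// /A ?addr_ge0 ?sqrtr_ge0// lerDl.
(* the remainder of the expansion then contributes at most half of (q, f) *)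
pose e : R := - inner Omega q f / (2 * A).
have e0 : 0 < e by rewrite divr_gt0 ?oppr_gt0// mulr_gt0//; lra.
have [n] : exists n, (norm2 Omega (fun z => f z - \sum_(k < n) c k * psi k z)%R < e%:E)%E.
  have /(_ [set x | (x < e%:E)%E]) := complete f Lf.
  case; first by apply: open_nbhs_nbhs; split; [exact: open_ereal_lt_ereal|rewrite /= lte_fin].
  by move=> N _ /(_ N (leqnn N)); exists N.
have Ls := L2_partial_sum c n Lpsi.
move=> /(norm2_lt (L2B Lf Ls) e0)/ltW fse.
have := inner_le Lq (L2B Lf Ls) (le_trans ler01 A1) (ltW e0) qA fse.
rewrite innerBr// ler_norml => /andP[H _].
have := qs n.
have eA : A * e = - inner Omega q f / 2 by rewrite /e; field; lra.
move: H; rewrite eA.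
lra.
Qed.

(** The plane spanned by f1 and f2 contains a nonzero vector orthogonal to the
    ground state, and without cross terms its Rayleigh quotient is at most r. *)
Lemma second_eigenvalue_le_rayleigh Omega psi (lam : nat -> R) (r : R) f1 f2 h1 h2 :
  hilbert_basis Omega psi -> {homo lam : j k / (j <= k)%N >-> j <= k} ->
  L2 Omega f1 -> L2 Omega f2 -> L2 Omega h1 -> L2 Omega h2 ->
  (forall k, inner Omega h1 (psi k) = lam k * inner Omega f1 (psi k)) ->
  (forall k, inner Omega h2 (psi k) = lam k * inner Omega f2 (psi k)) ->
  inner Omega f1 f2 = 0 -> inner Omega h1 f2 = 0 -> inner Omega h2 f1 = 0 ->
  0 < inner Omega f1 f1 -> 0 < inner Omega f2 f2 ->
  inner Omega h1 f1 <= r * inner Omega f1 f1 ->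
  inner Omega h2 f2 <= r * inner Omega f2 f2 ->
  lam 1%N <= r.
Proof.
move=> basis lam_le Lf1 Lf2 Lh1 Lh2 e1 e2 f12 h12 h21 n1 n2 r1 r2.
have [Lpsi _ _] := basis.
have [a [b [nz orth]]] : exists a b : R, 0 < a ^+ 2 + b ^+ 2 /\
    a * inner Omega f1 (psi 0%N) + b * inner Omega f2 (psi 0%N) = 0.
  have [c0|c0] := eqVneq (inner Omega f1 (psi 0%N)) 0.
    by exists 1, 0; rewrite c0 expr1n expr0n/= addr0 mulr0 mul0r addr0 ltr01.
  (* coefficients for which the combination is orthogonal to the ground state *)
  exists (- inner Omega f2 (psi 0%N)), (inner Omega f1 (psi 0%N)); split.
    by rewrite ltr_wpDl ?sqr_ge0// lt_neqAle sqr_ge0 eq_sym sqrf_eq0 c0.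
  by rewrite mulNr mulrC addNr.
pose f z := a * f1 z + b * f2 z.
pose h z := a * h1 z + b * h2 z.
have Lf : L2 Omega f by exact: L2_comb.
have Lh : L2 Omega h by exact: L2_comb.
have hf k : inner Omega h (psi k) = lam k * inner Omega f (psi k).
  by rewrite !inner_combl// e1 e2; ring.
have f0 : inner Omega f (psi 0%N) = 0 by rewrite inner_combl.
have := second_eigenvalue_le_form basis lam_le Lf Lh hf f0.
have -> : inner Omega f f = a ^+ 2 * inner Omega f1 f1 + b ^+ 2 * inner Omega f2 f2.
  by rewrite inner_combl// !inner_combr// (innerC _ f2 f1) f12; ring.
have -> : inner Omega h f = a ^+ 2 * inner Omega h1 f1 + b ^+ 2 * inner Omega h2 f2.
  by rewrite inner_combl// !inner_combr// h12 h21; ring.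
move=> key.
have k1 := ler_wpM2l (sqr_ge0 a) r1.
have k2 := ler_wpM2l (sqr_ge0 b) r2.
have pos : 0 < a ^+ 2 * inner Omega f1 f1 + b ^+ 2 * inner Omega f2 f2.
  have [a0|a0] := eqVneq a 0.
    by move: nz; rewrite a0 expr0n/= mul0r !add0r => nz; rewrite mulr_gt0.
  apply: ltr_pwDl; last by rewrite mulr_ge0 ?sqr_ge0// ltW.
  by rewrite mulr_gt0// lt_neqAle sqr_ge0 eq_sym sqrf_eq0 a0.
rewrite -(ler_pM2r pos); apply: (le_trans key); rewrite mulrDr.
apply: le_trans (lerD k1 k2) _.
by rewrite (mulrCA r) (mulrCA r).
Qed.

End Spectral.

(** * Smooth functions of one variable *)

Section SmoothLine.
Context {R : realType}.
Implicit Types (f g df dg p q : R -> R).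

(** Differentiability n times, with an explicit derivative at each stage, so that
    the closure properties are plain inductions on n. *)
Fixpoint diff_upto (n : nat) f : Prop :=
  if n is n'.+1 then
    exists2 df, (forall x, is_derive x (1 : R) f (df x)) & diff_upto n' df
  else True.

Definition smooth_line f : Prop := forall n, diff_upto n f.

Lemma is_derive_unique f (x a b : R) :
  is_derive x (1 : R) f a -> is_derive x (1 : R) f b -> a = b.
Proof. by move=> [_ <-] [_ <-]. Qed.

Lemma smooth_line_derive f : smooth_line f ->
  exists2 df, (forall x, is_derive x (1 : R) f (df x)) & smooth_line df.
Proof.
move=> sf; have [df fdf _] := sf 1%N; exists df => // n.
have [df' fdf' ndf'] := sf n.+1.
suff -> : df = df' by [].
by apply/funext => x; exact: is_derive_unique (fdf x) (fdf' x).
Qed.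

(** A class of functions that is stable under differentiation consists of smooth
    functions. *)
Lemma smooth_line_class (S : (R -> R) -> Prop) f :
  (forall g, S g -> exists2 dg, (forall x, is_derive x (1 : R) g (dg x)) & S dg) ->
  S f -> smooth_line f.
Proof.
move=> SP Sf n; elim: n f Sf => [//|n IHn] f /SP [df fdf Sdf].
by exists df => //; exact: IHn.
Qed.

Lemma diff_uptoW n f : diff_upto n.+1 f -> diff_upto n f.
Proof.
elim: n f => [//|n IHn] f [df fdf ndf]; exists df => //; exact: IHn.
Qed.

Lemma diff_uptoD n f g : diff_upto n f -> diff_upto n g ->
  diff_upto n (fun x => f x + g x).
Proof.
elim: n f g => [//|n IHn] f g [df fdf ndf] [dg gdg ndg].
exists (fun x => df x + dg x); last exact: IHn.
by move=> x; have := fdf x => F; have := gdg x => G; apply: is_deriveD.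
Qed.

Lemma diff_uptoM n f g : diff_upto n f -> diff_upto n g ->
  diff_upto n (fun x => f x * g x).
Proof.
elim: n f g => [//|n IHn] f g nf ng.
have [df fdf ndf] := nf; have [dg gdg ndg] := ng.
exists (fun x => f x * dg x + g x * df x).
  move=> x; have := fdf x => F; have := gdg x => G.
  by apply: is_derive_eq.
by apply: diff_uptoD; apply: IHn => //; exact: diff_uptoW.
Qed.

Lemma diff_upto_comp n f g : diff_upto n f -> diff_upto n g -> diff_upto n (f \o g).
Proof.
elim: n f g => [//|n IHn] f g [df fdf ndf] ng.
have [dg gdg ndg] := ng.
exists (fun x => (df \o g) x * dg x).
  by move=> x; exact: is_derive1_comp (fdf (g x)) (gdg x).
by apply: diff_uptoM => //; apply: IHn => //; exact: diff_uptoW.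
Qed.

Lemma smooth_lineM f g : smooth_line f -> smooth_line g -> smooth_line (fun x => f x * g x).
Proof. by move=> sf sg n; exact: diff_uptoM. Qed.

Lemma smooth_line_comp f g : smooth_line f -> smooth_line g -> smooth_line (f \o g).
Proof. by move=> sf sg n; exact: diff_upto_comp. Qed.

Lemma smooth_line_affine (a b : R) : smooth_line (fun x => a * x + b).
Proof.
apply: (@smooth_line_class (fun f => exists a b : R, f = fun x => a * x + b)).
  move=> _ [c [d ->]]; exists (fun x => 0 * x + c); last by exists 0, c.
  by move=> x; apply: is_derive_eq; rewrite /GRing.scale /=; ring.
by exists a, b.
Qed.

Lemma smooth_line_sin : smooth_line sin.
Proof.
apply: (@smooth_line_class (fun f => exists a b : R, f = fun x => a * sin x + b * cos x)).
  move=> _ [c [d ->]]; exists (fun x => - d * sin x + c * cos x); last by exists (- d), c.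
  by move=> x; apply: is_derive_eq; rewrite /GRing.scale /=; ring.
by exists 1, 0; apply/funext => x; rewrite mul1r mul0r addr0.
Qed.

Definition cutoff (a b : R) f : R -> R := fun x => if a < x < b then f x else 0.

Lemma is_derive_cst_near f (x e : R) : 0 < e -> (forall t, `|t - x| < e -> f t = 0) ->
  is_derive x (1 : R) f 0.
Proof.
move=> e0 f0; apply: (@near_eq_is_derive _ _ _ (cst 0)).
near=> t; rewrite /cst f0//; near: t; apply/nbhs_ballP; exists e => //= t.
Unshelve. all: by end_near. Qed.

(** A function that vanishes near a and b can be set to zero outside the interval
    between them; the derivative has the same property, which drives the
    induction. *)
Lemma diff_upto_cutoff n (a b e : R) f : 0 < e ->
  (forall t, `|t - a| < e -> f t = 0) -> (forall t, `|t - b| < e -> f t = 0) ->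
  diff_upto n f -> diff_upto n (cutoff a b f).
Proof.
move=> e0; elim: n f => [//|n IHn] f fa fb [df fdf ndf].
have dfc c : (forall t, `|t - c| < e -> f t = 0) -> forall t, `|t - c| < e -> df t = 0.
  move=> fc t tc; apply: is_derive_unique (fdf t) _.
  apply: (@is_derive_cst_near _ _ (e - `|t - c|)); first by rewrite subr_gt0.
  move=> s st; apply: fc.
  have -> : s - c = (s - t) + (t - c) by ring.
  by apply: (le_lt_trans (ler_normD _ _)); rewrite -ltrBrDr.
exists (cutoff a b df); last by apply: IHn => //; exact: dfc.
move=> x.
have zero c : `|x - c| < e -> (forall t, `|t - c| < e -> f t = 0) ->
    is_derive x (1 : R) (cutoff a b f) (cutoff a b df x).
  move=> xc fc; have -> : cutoff a b df x = 0.
    by rewrite /cutoff (dfc c fc)//; case: ifP.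
  apply: (@is_derive_cst_near _ _ (e - `|x - c|)); first by rewrite subr_gt0.
  move=> s st; rewrite /cutoff fc ?if_same//.
  have -> : s - c = (s - x) + (x - c) by ring.
  by apply: (le_lt_trans (ler_normD _ _)); rewrite -ltrBrDr.
have [xa|xa|xa] := ltgtP x a; last by apply: (zero a) => //; rewrite xa subrr normr0.
  have -> : cutoff a b df x = 0 by rewrite /cutoff ltNge (ltW xa).
  apply: (@is_derive_cst_near _ _ (a - x)); first by rewrite subr_gt0.
  move=> s; rewrite ltr_norml => /andP[_ sx].
  by rewrite /cutoff ltNge; have -> : s <= a by lra.
have [xb|xb|xb] := ltgtP x b; last by apply: (zero b) => //; rewrite xb subrr normr0.
  have -> : cutoff a b df x = df x by rewrite /cutoff xa xb.
  apply: near_eq_is_derive (fdf x); near=> t; rewrite /cutoff.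
  have -> : a < t by near: t; exact: lt_nbhsr.
  by have -> : t < b by near: t; exact: lt_nbhsl.
have -> : cutoff a b df x = 0 by rewrite /cutoff (ltNge x) (ltW xb) andbF.
apply: (@is_derive_cst_near _ _ (x - b)); first by rewrite subr_gt0.
move=> s; rewrite ltr_norml => /andP[sx _].
have bs : b <= s by lra.
by rewrite /cutoff (ltNge s) bs andbF.
Unshelve. all: by end_near. Qed.

End SmoothLine.

(** * A smooth approximation of the positive part *)

Section FlatFunctions.
Context {R : realType}.
Implicit Types (f g : R -> R) (P : {poly R}).

(** The functions P(1/t) exp(-1/t), extended by 0 to t <= 0: a family that
    contains exp(-1/t) and is stable under differentiation. *)
Definition poly_exp_inv P (t : R) : R := if 0 < t then P.[t^-1] * expR (- t^-1) else 0.

Lemma poly_expR_bound P (n : nat) :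
  exists2 C : R, 0 <= C & forall u, 0 < u -> `|P.[u]| * u ^+ n <= C * expR u.
Proof.
elim/poly_ind: P n => [|P c IHP] n.
  by exists 0 => // u _; rewrite horner0 normr0 !mul0r.
have [C C0 CP] := IHP n.+1.
(* u ^ n <= n! exp u bounds the contribution of the constant coefficient *)
exists (C + `|c| * n`!%:R); first by rewrite addr_ge0// mulr_ge0.
move=> u u0; rewrite hornerMXaddC mulrDl.
have un : u ^+ n <= n`!%:R * expR u.
  case: n {IHP CP} => [|n].
    by rewrite expr0 mul1r -[leLHS]expR0 ler_expR ltW.
  have := expR_ge1Dxn n (ltW u0) => H.
  rewrite -ler_pdivrMl ?ltr0n ?fact_gt0// mulrC.
  by apply: le_trans H; rewrite lerDr.
apply: (@le_trans _ _ ((`|P.[u] * u| + `|c|) * u ^+ n)).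
  by rewrite ler_wpM2r ?exprn_ge0 ?(ltW u0)// ler_normD.
rewrite mulrDl lerD//.
  by rewrite normrM (gtr0_norm u0) -mulrA -exprS CP.
by rewrite -mulrA ler_wpM2l.
Qed.

Lemma is_derive_quadratic f (C : R) : (forall t, `|f t| <= C * t ^+ 2) ->
  is_derive (0 : R) (1 : R) f 0.
Proof.
move=> fC.
have C0 : 0 <= C by have := le_trans (normr_ge0 _) (fC 1); rewrite expr1n mulr1.
have f0 : f 0 = 0.
  by apply/eqP; rewrite -normr_le0; have := fC 0; rewrite expr0n mulr0.
have H : h^-1 *: (f (h *: (1 : R) + 0) - f 0) @[h --> (0 : R)^'] --> (0 : R).
  apply/cvgr0Pnorm_lt => e e0; near=> h.
  have h0 : h != 0 by near: h; exact: nbhs_dnbhs_neq.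
  rewrite addr0 f0 subr0 [h *: 1]mulr1 normrM normfV.
  rewrite ltr_pdivrMl ?normr_gt0//.
  apply: (le_lt_trans (fC h)); rewrite -real_normK ?num_real// expr2 mulrA mulrC.
  rewrite ltr_pM2l ?normr_gt0//.
  have : `|h| < e / (C + 1).
    near: h; apply: dnbhs0_lt; rewrite divr_gt0// ltr_wpDl//.
  rewrite ltr_pdivlMr ?ltr_wpDl// => H.
  apply: le_lt_trans H; rewrite mulrC ler_wpM2l// lerDl//.
split; first by apply/cvg_ex; exists 0.
exact: cvg_lim H.
Unshelve. all: by end_near. Qed.

(** The family is stable under differentiation, which makes its members smooth;
    at 0 the derivative vanishes because the exponential beats P(1/t) / t^2. *)
Lemma is_derive_poly_exp_inv P (t : R) :
  is_derive t (1 : R) (poly_exp_inv P) (poly_exp_inv ('X^2 * (P - P^`())) t).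
Proof.
have [t0|t0|->] := ltgtP t 0.
- have -> : poly_exp_inv ('X^2 * (P - P^`())) t = 0 by rewrite /poly_exp_inv ltNge (ltW t0).
  apply: (@near_eq_is_derive _ _ _ (cst 0)); near=> s.
  have s0 : s < 0 by near: s; exact: lt_nbhsl.
  by rewrite /poly_exp_inv ltNge (ltW s0).
- have -> : poly_exp_inv ('X^2 * (P - P^`())) t =
      P.[t^-1] * (expR (- t^-1) * t ^- 2) + expR (- t^-1) * (P^`().[t^-1] * - t ^- 2).
    by rewrite /poly_exp_inv t0 hornerM hornerXn hornerD hornerN exprVn; ring.
  pose F : R -> R := fun s => P.[s^-1] * expR (- s^-1).
  apply: (@near_eq_is_derive _ _ _ F).
    near=> s; have s0 : 0 < s by near: s; exact: lt_nbhsr.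
    by rewrite /poly_exp_inv s0.
  have tn0 : t != 0 by rewrite gt_eqF.
  have I : is_derive t (1 : R) (fun s : R => s^-1) (- t ^- 2).
    by have := @is_deriveV R id t 1 1 tn0 _; rewrite /GRing.scale /= mulr1; apply.
  have NI : is_derive t (1 : R) (fun s : R => - s^-1) (t ^- 2).
    by apply: is_derive_eq; rewrite opprK.
  have A := @is_derive1_comp R (horner P) (fun s => s^-1) t _ _ (is_derive_poly P _) I.
  have B := @is_derive1_comp R expR (fun s => - s^-1) t _ _ (is_derive_expR _) NI.
  exact: (is_deriveM A B).
have -> : poly_exp_inv ('X^2 * (P - P^`())) 0 = 0 by rewrite /poly_exp_inv ltxx.
have [C C0 CP] := poly_expR_bound P 2.
apply: (@is_derive_quadratic _ C) => s; rewrite /poly_exp_inv.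
case: ifPn => s0; last by rewrite normr0 mulr_ge0// sqr_ge0.
have := CP s^-1; rewrite invr_gt0 => /(_ s0).
rewrite exprVn ler_pdivrMr ?exprn_gt0// => H.
rewrite normrM (gtr0_norm (expR_gt0 _)) expRN ler_pdivrMr ?expR_gt0//.
by apply: (le_trans H); rewrite mulrAC.
Unshelve. all: by end_near. Qed.

Lemma smooth_line_poly_exp_inv P : smooth_line (poly_exp_inv P).
Proof.
apply: (@smooth_line_class R (fun f => exists P, f = poly_exp_inv P)); last by exists P.
move=> _ [Q ->]; exists (poly_exp_inv ('X^2 * (Q - Q^`()))); last by eexists.
exact: is_derive_poly_exp_inv.
Qed.

(** (t - eta) exp(- eta / (t - eta)) for t > eta and 0 otherwise: a smooth
    function that vanishes below eta, has slope at most 1, and stays within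
    2 eta of the identity for t >= 0. *)
Definition shrink (eta t : R) : R := (t - eta) * poly_exp_inv 1 (eta^-1 * t + -1).

Lemma smooth_line_shrink eta : smooth_line (shrink eta).
Proof.
apply: smooth_lineM.
  have := smooth_line_affine 1 (- eta); congr smooth_line.
  by apply/funext => t; rewrite mul1r.
exact: (smooth_line_comp (smooth_line_poly_exp_inv 1) (smooth_line_affine _ _)).
Qed.

Lemma shrink_below (eta t : R) : 0 < eta -> t <= eta -> shrink eta t = 0.
Proof.
move=> eta0 te; rewrite /shrink /poly_exp_inv ifN ?mulr0// -leNgt subr_le0.
by rewrite ler_pdivrMl// mulr1.
Qed.

(** From exp(-u) >= 1 - u with u = eta / (t - eta). *)
Lemma shrink_ge (eta t : R) : 0 < eta -> t - 2 * eta <= shrink eta t.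
Proof.
move=> eta0; have [te|te] := leP t eta; first by rewrite shrink_below//; lra.
rewrite /shrink /poly_exp_inv.
have d0 : 0 < t - eta by rewrite subr_gt0.
have E : eta^-1 * t + -1 = (t - eta) / eta by field; lra.
rewrite E divr_gt0// hornerC mul1r invf_div.
have := expR_ge1Dx (- (eta / (t - eta))) => H.
have := ler_wpM2l (ltW d0) H; rewrite mulrDr mulr1 mulrN mulrCA divff ?gt_eqF//.
by lra.
Qed.

(** For t > eta and z = (t - eta) / eta the derivative is exp(-1/z) (1 + 1/z),
    and 1 + 1/z <= exp(1/z). *)
Lemma shrink_derive (eta t : R) : 0 < eta ->
  exists2 d, is_derive t (1 : R) (shrink eta) d & 0 <= d <= 1.
Proof.
move=> eta0; pose z := eta^-1 * t + -1.
exists (poly_exp_inv 1 z + (t - eta) * (poly_exp_inv ('X^2 * (1 - 1^`())) z * eta^-1)).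
  have L : is_derive t (1 : R) (fun s => eta^-1 * s + -1) eta^-1.
    by apply: is_derive_eq; rewrite /GRing.scale /=; ring.
  have A := @is_derive1_comp R (poly_exp_inv 1) (fun s => eta^-1 * s + -1) t _ _ (is_derive_poly_exp_inv 1 _) L.
  have B : is_derive t (1 : R) (fun s => s - eta) 1.
    by apply: is_derive_eq; rewrite subr0.
  have := is_deriveM B A => H; apply: is_derive_eq H _.
  by rewrite /GRing.scale /= addrC mulr1.
rewrite /poly_exp_inv; case: ifPn => z0; last by rewrite mul0r mulr0 addr0 lexx ler01.
rewrite derivC subr0 mulr1 hornerXn hornerC mul1r.
have d0 : t - eta = eta * z by rewrite /z; field; lra.
have -> : expR (- z^-1) + (t - eta) * (z^-1 ^+ 2 * expR (- z^-1) * eta^-1) =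
   expR (- z^-1) * (1 + z^-1) by rewrite d0; field; lra.
have zi : 0 < z^-1 by rewrite invr_gt0.
rewrite mulr_ge0 ?expR_ge0//=; last lra.
by rewrite expRN ler_pdivrMl ?expR_gt0// mulr1 expR_ge1Dx.
Qed.

End FlatFunctions.

(** * Trial functions on an interval *)

Section TrialFunction.
Context {R : realType}.
Implicit Types (f g p dp : R -> R).

Local Notation mu := (@lebesgue_measure R).

Lemma continuous_sq f : continuous f -> continuous (fun x => f x ^+ 2).
Proof. by move=> cf x; apply: cvgM; exact: cf. Qed.

(** The sum of the two integrals is l, and their difference vanishes because
    cos^2 - sin^2 is, up to a factor, the derivative of sin * cos. *)
Lemma integral_sin_sq (a l : R) : 0 < l ->
  \int[mu]_(x in `[a, a + l]) sin (pi / l * (x - a)) ^+ 2 = l / 2 /\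
  \int[mu]_(x in `[a, a + l]) cos (pi / l * (x - a)) ^+ 2 = l / 2.
Proof.
move=> l0; pose k : R := pi / l; pose s x := sin (k * (x - a)); pose c x := cos (k * (x - a)).
have pi0 : 0 < pi :> R := pi_gt0 R.
have k0 : k != 0 by rewrite gt_eqF// divr_gt0.
have dlin x : is_derive x (1 : R) (fun x => k * (x - a)) k.
  by apply: is_derive_eq; rewrite /GRing.scale /=; ring.
have ds x : is_derive x (1 : R) s (c x * k).
  exact: (@is_derive1_comp R sin (fun x => k * (x - a)) x _ _ (is_derive_sin _) (dlin x)).
have dc x : is_derive x (1 : R) c (- s x * k).
  exact: (@is_derive1_comp R cos (fun x => k * (x - a)) x _ _ (is_derive_cos _) (dlin x)).
have cs : continuous s by move=> x; exact: is_derive_continuous (ds x).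
have cc : continuous c by move=> x; exact: is_derive_continuous (dc x).
have ab : a < a + l by rewrite ltrDl.
have Is : mu.-integrable `[a, a + l] (EFin \o (fun x => s x ^+ 2)).
  by apply: continuous_integrable_itv => x _; exact: continuous_sq.
have Ic : mu.-integrable `[a, a + l] (EFin \o (fun x => c x ^+ 2)).
  by apply: continuous_integrable_itv => x _; exact: continuous_sq.
have sum : \int[mu]_(x in `[a, a + l]) s x ^+ 2 + \int[mu]_(x in `[a, a + l]) c x ^+ 2 = l.
  rewrite -RintegralD// (@Rintegral_derivative R a (a + l) id (fun x => s x ^+ 2 + c x ^+ 2))//.
  - by rewrite addrAC subrr add0r.
  - move=> x _; rewrite (_ : s x ^+ 2 + c x ^+ 2 = 1); first exact: is_derive_id.
    by rewrite addrC cos2Dsin2.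
  - by move=> x _; apply: cvgD; exact: continuous_sq.
have dif : \int[mu]_(x in `[a, a + l]) c x ^+ 2 - \int[mu]_(x in `[a, a + l]) s x ^+ 2 = 0.
  rewrite -RintegralB//.
  rewrite (@Rintegral_derivative R a (a + l) (fun x => k^-1 * (s x * c x))
    (fun x => c x ^+ 2 - s x ^+ 2))//.
  - have -> : s (a + l) = 0.
      rewrite /s (_ : k * (a + l - a) = pi) ?sinpi// /k; field.
      by rewrite gt_eqF.
    have -> : s a = 0 by rewrite /s subrr mulr0 sin0.
    by rewrite !mul0r !mulr0 subrr.
  - move=> x _; have S := ds x; have C := dc x.
    by apply: is_derive_eq; rewrite /GRing.scale /=; field.
  - by move=> x _; apply: cvgB; exact: continuous_sq.
by rewrite -/k -/(s _); split; lra.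
Qed.

Lemma sq_shrink_ge (s f eta : R) : 0 <= s -> s <= 1 -> 0 < eta ->
  s - 2 * eta <= f -> s ^+ 2 - 4 * eta <= f ^+ 2.
Proof.
move=> s0 s1 eta0 sf; have [big|sm] := leP (2 * eta) s; last first.
  by have := sqr_ge0 f; nra.
have : (s - 2 * eta) ^+ 2 <= f ^+ 2 by rewrite ler_pXn2r// nnegrE; lra.
by nra.
Qed.

(** The function is G(sin (pi (x - a) / l)), with G = [shrink eta], set to zero
    outside the interval.  Since 0 <= G' <= 1 the integral of its squared
    derivative is at most (pi / l)^2 (l / 2), and since G(s) >= s - 2 eta the
    integral of its square is at least (l / 2) (1 - 8 eta).  The margin e makes
    the support compact. *)
Lemma interval_trial_exists (a l eta : R) : 0 < l -> 0 < eta -> 8 * eta < 1 ->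
  exists p, [/\ smooth_line p,
    exists2 e : R, 0 < e & forall x, p x != 0 -> a + e <= x <= a + l - e,
    0 < \int[mu]_(x in `[a, a + l]) p x ^+ 2 &
    forall dp, (forall x, is_derive x (1 : R) p (dp x)) -> continuous dp ->
      (1 - 8 * eta) * \int[mu]_(x in `[a, a + l]) dp x ^+ 2 <=
      (pi / l) ^+ 2 * \int[mu]_(x in `[a, a + l]) p x ^+ 2].
Proof.
move=> l0 eta0 eta8; pose k : R := pi / l.
have pi0 : 0 < pi :> R := pi_gt0 R.
have k0 : 0 < k by rewrite divr_gt0.
have kl : k * l = pi by rewrite /k divfK// gt_eqF.
pose s x := sin (k * (x - a)); pose c x := cos (k * (x - a)).
have dlin x : is_derive x (1 : R) (fun x => k * (x - a)) k.
  by apply: is_derive_eq; rewrite /GRing.scale /=; ring.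
have ds x : is_derive x (1 : R) s (c x * k).
  exact: (@is_derive1_comp R sin (fun x => k * (x - a)) x _ _ (is_derive_sin _) (dlin x)).
have dc x : is_derive x (1 : R) c (- s x * k).
  exact: (@is_derive1_comp R cos (fun x => k * (x - a)) x _ _ (is_derive_cos _) (dlin x)).
have cs : continuous s by move=> x; exact: is_derive_continuous (ds x).
have cc : continuous c by move=> x; exact: is_derive_continuous (dc x).
have sa : s a = 0 by rewrite /s subrr mulr0 sin0.
have sb : s (a + l) = 0 by rewrite /s (addrC a) addrK kl sinpi.
have small (x : R) : s x = 0 -> exists2 e : R, 0 < e & forall t, `|t - x| < e -> s t <= eta.
  move=> sx; have := cs x => /cvgr_lt /(_ eta); rewrite sx => /(_ eta0).
  move=> /nbhs_ballP[e /= e0 eP]; exists e => // t tx; apply/ltW/eP.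
  by rewrite /ball/= distrC.
have [ea ea0 eaP] := small a sa; have [eb eb0 ebP] := small _ sb.
pose e : R := Num.min ea eb.
have e0 : 0 < e by rewrite lt_min ea0.
pose f := shrink eta \o s.
have fa t : `|t - a| < e -> f t = 0.
  by rewrite lt_min => /andP[/eaP ta _]; exact: shrink_below.
have fb t : `|t - (a + l)| < e -> f t = 0.
  by rewrite lt_min => /andP[_ /ebP tb]; exact: shrink_below.
have sf : smooth_line f.
  apply: smooth_line_comp; first exact: smooth_line_shrink.
  have -> : s = sin \o (fun x => k * x + (- k * a)).
    by apply/funext => x; rewrite /s /=; congr sin; ring.
  by apply: smooth_line_comp; [exact: smooth_line_sin|exact: smooth_line_affine].
pose p := cutoff a (a + l) f.
have sp : smooth_line p by move=> n; exact: (diff_upto_cutoff e0 fa fb (sf n)).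
have cp : continuous p.
  by have [dp pdp _] := smooth_line_derive sp; move=> x; exact: is_derive_continuous (pdp x).
have s01 x : a <= x <= a + l -> 0 <= s x <= 1.
  move=> /andP[x1 x2]; rewrite /s sin_le1 andbT; apply: sin_ge0_pi.
  rewrite mulr_ge0 ?(ltW k0) ?subr_ge0//= -kl ler_pM2l//.
  by rewrite lerBlDr (addrC l).
have [Is Ic] := integral_sin_sq a l0.
have Ip2 : mu.-integrable `[a, a + l] (EFin \o (fun x => p x ^+ 2)).
  by apply: continuous_integrable_itv => x _; exact: continuous_sq.
have p2 : l / 2 * (1 - 8 * eta) <= \int[mu]_(x in `[a, a + l]) p x ^+ 2.
  have <- : \int[mu]_(x in `[a, a + l]) (s x ^+ 2 - 4 * eta) = l / 2 * (1 - 8 * eta).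
    rewrite RintegralB//; first last.
    - by apply: continuous_integrable_itv => x _; exact: cvg_cst.
    - by apply: continuous_integrable_itv => x _; exact: continuous_sq.
    by rewrite Is Rintegral_cst//= lebesgue_measure_itv/= lte_fin ltrDl l0 -EFinB /=; field.
  apply: le_Rintegral => //.
    apply: continuous_integrable_itv => x _; apply: cvgB; last exact: cvg_cst.
    exact: continuous_sq.
  move=> x; rewrite /= in_itv/= => /[dup] xab /andP[xa xb].
  have /andP[s0 s1] := s01 x xab.
  have [xa'|xa'] := eqVneq x a; first by rewrite xa' sa expr0n /=; have := sqr_ge0 (p a); lra.
  have [xb'|xb'] := eqVneq x (a + l).
    by rewrite xb' sb expr0n /=; have := sqr_ge0 (p (a + l)); lra.
  have -> : p x = f x by rewrite /p /cutoff !lt_neqAle xa xb xb' eq_sym xa'.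
  exact: (sq_shrink_ge s0 s1 eta0 (shrink_ge (s x) eta0)).
exists p; split => //.
- exists e => // x; rewrite /p /cutoff; case: ifPn => [|_]; last by rewrite eqxx.
  move=> /andP[xa xb] fx; apply/andP; split; rewrite leNgt; apply/negP => xe.
    by move/eqP: fx; apply; apply: fa; rewrite gtr0_norm ?subr_gt0// ltrBlDl.
  by move/eqP: fx; apply; apply: fb; rewrite ltr0_norm ?subr_lt0//; lra.
- by apply: lt_le_trans p2; rewrite mulr_gt0 ?divr_gt0//; lra.
move=> dp pdp cdp.
have dp2 : \int[mu]_(x in `[a, a + l]) dp x ^+ 2 <= k ^+ 2 * (l / 2).
  rewrite -[X in _ * X]Ic -RintegralZl//; last first.
    by apply: continuous_integrable_itv => x _; exact: continuous_sq.
  apply: le_Rintegral => //.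
  - by apply: continuous_integrable_itv => x _; exact: continuous_sq.
  - apply: continuous_integrable_itv => x _; apply: cvgM; first exact: cvg_cst.
    exact: continuous_sq.
  move=> x; rewrite /= in_itv/= => /[dup] xab /andP[xa xb].
  have dp0 y : (forall t, `|t - y| < e -> f t = 0) -> dp y = 0.
    move=> fy; apply: is_derive_unique (pdp y) _; apply: (is_derive_cst_near e0) => t ty.
    by rewrite /p /cutoff fy// if_same.
  have [xa'|xa'] := eqVneq x a.
    have -> : dp x = 0 by rewrite xa'; exact: dp0.
    by rewrite expr0n/= mulr_ge0 ?sqr_ge0.
  have [xb'|xb'] := eqVneq x (a + l).
    have -> : dp x = 0 by rewrite xb'; exact: dp0.
    by rewrite expr0n/= mulr_ge0 ?sqr_ge0.
  have [d sd /andP[d0 d1]] := shrink_derive (s x) eta0.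
  have fx : is_derive (x : R) (1 : R) f (d * (c x * k)).
    exact: (@is_derive1_comp R (shrink eta) s x _ _ sd (ds x)).
  have : is_derive (x : R) (1 : R) p (d * (c x * k)).
    apply: near_eq_is_derive fx.
    near=> t; rewrite /p /cutoff.
    have -> : a < t by near: t; apply: lt_nbhsr; rewrite lt_neqAle xa eq_sym xa'.
    by have -> : t < a + l by near: t; apply: lt_nbhsl; rewrite lt_neqAle xb xb'.
  move=> /(is_derive_unique (pdp x)) ->; rewrite -/k -/(c x).
  have -> : (d * (c x * k)) ^+ 2 = d ^+ 2 * (k ^+ 2 * c x ^+ 2) by ring.
  by apply: ler_piMl; [rewrite mulr_ge0 ?sqr_ge0|rewrite expr_le1].
apply: (@le_trans _ _ ((1 - 8 * eta) * (k ^+ 2 * (l / 2)))).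
  by rewrite ler_wpM2l//; lra.
rewrite mulrCA (mulrC (1 - _)) ler_wpM2l// sqr_ge0//.
Unshelve. all: by end_near. Qed.

End TrialFunction.

(** * Products of functions of one variable *)

Section Tensor.
Context {R : realType}.
Implicit Types (p q dp dq : R -> R).

Local Notation mu := (@lebesgue_measure R).

Definition tensor p q : R * R -> R := fun z => p z.1 * q z.2.

(** Converse of [derivable_slice]. *)
Lemma is_derive_line (g : R -> R) (phi : R * R -> R) (z v : R * R) (x l : R) :
  (forall h : R, phi (h *: v + z) = g (h + x)) -> is_derive x (1 : R) g l ->
  is_derive z v phi l.
Proof.
move=> phig [dg gl].
have E : (fun h : R => h^-1 *: (phi (h *: v + z) - phi z)) =
         (fun h : R => h^-1 *: (g (h *: (1 : R) + x) - g x)).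
  apply/funext => h; rewrite phig -[X in phi X]add0r -[X in phi (X + _)](scale0r v).
  by rewrite phig add0r [h *: 1]mulr1.
split; first by move: dg; rewrite /derivable/= E.
by rewrite -gl /derive/= E.
Qed.

Lemma tensor_derive0 p q dp (z : R * R) : (forall x, is_derive x (1 : R) p (dp x)) ->
  is_derive z (axis ord0) (tensor p q) (tensor dp q z).
Proof.
move=> pdp; case: z => x y.
apply: (@is_derive_line (fun t => p t * q y) _ _ _ x).
  by move=> h; rewrite /tensor /axis /GRing.scale /= /GRing.scale /= mulr1 mulr0 add0r.
have P := pdp x; apply: is_derive_eq.
by rewrite /tensor /GRing.scale /=; ring.
Qed.

Lemma tensor_derive1 p q dq (i : 'I_2) (z : R * R) : i != ord0 ->
  (forall x, is_derive x (1 : R) q (dq x)) ->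
  is_derive z (axis i) (tensor p q) (tensor p dq z).
Proof.
move=> /negbTE i0 qdq; case: z => x y.
apply: (@is_derive_line (fun t => p x * q t) _ _ _ y).
  by move=> h; rewrite /tensor /axis i0 /GRing.scale /= /GRing.scale /= mulr1 mulr0 add0r.
Qed.

Lemma partial_tensor0 p q dp : (forall x, is_derive x (1 : R) p (dp x)) ->
  partial ord0 (tensor p q) = tensor dp q.
Proof. by move=> pdp; apply/funext => z; have [_ <-] := tensor_derive0 q z pdp. Qed.

Lemma partial_tensor1 p q dq (i : 'I_2) : i != ord0 ->
  (forall x, is_derive x (1 : R) q (dq x)) ->
  partial i (tensor p q) = tensor p dq.
Proof. by move=> i0 qdq; apply/funext => z; have [_ <-] := tensor_derive1 p z i0 qdq. Qed.

Lemma smooth_line_continuous p : smooth_line p -> continuous p.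
Proof. by move=> /smooth_line_derive[dp pdp _] x; exact: is_derive_continuous (pdp x). Qed.

Lemma tensor_continuous p q : continuous p -> continuous q -> continuous (tensor p q).
Proof.
move=> cp cq z; apply: cvgM.
- by apply: (continuous_comp (f := fst) (g := p)); [exact: cvg_fst|exact: cp].
- by apply: (continuous_comp (f := snd) (g := q)); [exact: cvg_snd|exact: cq].
Qed.

Lemma smooth_tensor p q : smooth_line p -> smooth_line q -> smooth (tensor p q).
Proof.
move=> sp sq s.
have [p' [q' [sp' sq' ->]]] : exists p' q', [/\ smooth_line p', smooth_line q' &
    iter_partial s (tensor p q) = tensor p' q'].
  elim: s => [|i s [p' [q' [sp' sq' E]]]]; first by exists p, q.
  rewrite /iter_partial/= -/(iter_partial s _) E.
  have [->|i0] := eqVneq i ord0.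
    have [dp pdp sdp] := smooth_line_derive sp'.
    by exists dp, q'; split => //; exact: partial_tensor0.
  have [dq qdq sdq] := smooth_line_derive sq'.
  by exists p', dq; split => //; exact: partial_tensor1.
split; first by apply: tensor_continuous; exact: smooth_line_continuous.
move=> i z; have [->|i0] := eqVneq i ord0.
  have [dp pdp sdp] := smooth_line_derive sp'.
  by have [] := tensor_derive0 q' z pdp.
have [dq qdq sdq] := smooth_line_derive sq'.
by have [] := tensor_derive1 p' z i0 qdq.
Qed.

Lemma tensor_test_function (a1 b1 a2 b2 c1 d1 c2 d2 : R) p q :
  smooth_line p -> smooth_line q ->
  (forall x, p x != 0 -> c1 <= x <= d1) -> (forall y, q y != 0 -> c2 <= y <= d2) ->
  a1 < c1 -> d1 < b1 -> a2 < c2 -> d2 < b2 ->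
  test_function (`]a1, b1[ `*` `]a2, b2[) (tensor p q).
Proof.
move=> sp sq pc qc ac1 db1 ac2 db2.
have cK : compact (`[c1, d1] `*` `[c2, d2] : set (R * R)).
  by apply: compact_setX; exact: segment_compact.
have clK : closed (`[c1, d1] `*` `[c2, d2] : set (R * R)).
  by apply: compact_closed => //; exact: norm_hausdorff.
have sub : closure [set z | tensor p q z != 0] `<=` `[c1, d1] `*` `[c2, d2].
  rewrite [X in _ `<=` X](closure_id _).1//; apply: closure_subset => -[x y] /=.
  rewrite /tensor mulf_eq0 negb_or /= => /andP[px qy].
  by split; rewrite /= in_itv/=; [exact: pc|exact: qc].
split; first exact: smooth_tensor.
- by apply: (subclosed_compact _ cK) => //; exact: closed_closure.
- move=> z /sub[/=]; rewrite !in_itv/= => /andP[x1 x2] /andP[y1 y2].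
  by split; apply/andP; split; lra.
Qed.

(** Fubini's theorem; the supports allow the integrals to be taken over any
    intervals that contain them. *)
Lemma inner_tensor (L a b c d : R) p1 p2 q1 q2 :
  L2 (square L) (tensor p1 q1) -> L2 (square L) (tensor p2 q2) ->
  continuous p1 -> continuous p2 -> continuous q1 -> continuous q2 ->
  (forall x, p1 x != 0 -> a < x < b) -> (forall y, q1 y != 0 -> c < y < d) ->
  - (L / 2) <= a -> b <= L / 2 -> - (L / 2) <= c -> d <= L / 2 ->
  inner (square L) (tensor p1 q1) (tensor p2 q2) =
  (\int[mu]_(x in `[a, b]) (p1 x * p2 x)) * (\int[mu]_(y in `[c, d]) (q1 y * q2 y)).
Proof.
move=> L1 L2' cp1 cp2 cq1 cq2 p1s q1s La bL Lc dL.
pose u := (fun x => p1 x * p2 x) \_ `[a, b].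
pose w := (fun y => q1 y * q2 y) \_ `[c, d].
have Iu : mu.-integrable setT (EFin \o u).
  rewrite /u -restrict_EFin; apply/integrable_restrict => //; rewrite setTI.
  by apply: continuous_integrable_itv => x _; apply: cvgM; [exact: cp1|exact: cp2].
have Iw : mu.-integrable setT (EFin \o w).
  rewrite /w -restrict_EFin; apply/integrable_restrict => //; rewrite setTI.
  by apply: continuous_integrable_itv => x _; apply: cvgM; [exact: cq1|exact: cq2].
rewrite [X in X * _]Rintegral_mkcond [X in _ * X]Rintegral_mkcond -/u -/w.
have E : (tensor p1 q1 \_ (square L)) \* (tensor p2 q2 \_ (square L)) =
    (fun z => u z.1 * w z.2).
  apply/funext => -[x y]; rewrite -restrict_mul /= /u /w /patch /=.
  have [p0|px] := eqVneq (p1 x) 0.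
    by rewrite /tensor /= p0 !mul0r !if_same mul0r.
  have [q0|qy] := eqVneq (q1 y) 0.
    by rewrite /tensor /= q0 mulr0 !mul0r !if_same mulr0.
  have /andP[x1 x2] := p1s _ px; have /andP[y1 y2] := q1s _ qy.
  rewrite !mem_set /=.
  - by rewrite /tensor /= mulrACA.
  - by rewrite in_itv/= !ltW.
  - by rewrite in_itv/= !ltW.
  - by split; rewrite /= in_itv/=; apply/andP; split; lra.
have II := L2_integrable L1 L2'; rewrite E in II.
rewrite innerE /Rintegral.
have -> : (\int[lebesgue2]_z ((tensor p1 q1 \_ (square L)) z * (tensor p2 q2 \_ (square L)) z)%R%:E =
   \int[lebesgue2]_z (u z.1 * w z.2)%R%:E)%E.
  by apply: eq_integral => z _; rewrite -[RHS]/((fun z => u z.1 * w z.2) z)%:E -E.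
rewrite -(integral12_prod_meas1 II) /fubini_F /=.
under eq_integral => x _.
  under eq_integral do rewrite EFinM.
  rewrite integralZl//; over.
rewrite /=.
have -> : (\int[mu]_x (w x)%:E = (\int[mu]_x w x)%R%:E)%E.
  by rewrite /Rintegral fineK// integrable_fin_num.
rewrite integralZr//.
have -> : (\int[mu]_x (u x)%:E = (\int[mu]_x u x)%R%:E)%E.
  by rewrite /Rintegral fineK// integrable_fin_num.
by [].
Qed.

Lemma integral_by_parts_compact (a b : R) p dp ddp : a < b ->
  (forall x, is_derive x (1 : R) p (dp x)) -> (forall x, is_derive x (1 : R) dp (ddp x)) ->
  continuous ddp -> p a = 0 -> p b = 0 ->
  \int[mu]_(x in `[a, b]) (ddp x * p x) = - \int[mu]_(x in `[a, b]) dp x ^+ 2.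
Proof.
move=> ab pdp dpddp cddp pa pb.
have cp : continuous p by move=> x; exact: is_derive_continuous (pdp x).
have cdp : continuous dp by move=> x; exact: is_derive_continuous (dpddp x).
have I1 : mu.-integrable `[a, b] (EFin \o (fun x => ddp x * p x)).
  by apply: continuous_integrable_itv => x _; apply: cvgM; [exact: cddp|exact: cp].
have I2 : mu.-integrable `[a, b] (EFin \o (fun x => dp x ^+ 2)).
  by apply: continuous_integrable_itv => x _; exact: continuous_sq.
apply/eqP; rewrite -addr_eq0 -RintegralD//; apply/eqP.
rewrite (@Rintegral_derivative R a b (fun x => p x * dp x))//.
- by rewrite pa pb !mul0r subrr.
- move=> x _; have P := pdp x; have D := dpddp x; apply: is_derive_eq.
  by rewrite /GRing.scale /=; ring.
- move=> x _; apply: cvgD; last exact: continuous_sq.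
  by apply: cvgM; [exact: cddp|exact: cp].
Qed.

End Tensor.

(** * Trial functions on rectangles *)

Section SecondEigenvalue.
Context {R : realType}.
Implicit Types (f g w phi : plane R -> R).

Local Notation mu := (@lebesgue_measure R).

Lemma inner_eq0 (Omega : set (plane R)) f g :
  (forall z, f z * g z = 0) -> inner Omega f g = 0.
Proof.
move=> fg; rewrite /inner /Rintegral.
by under eq_integral do rewrite fg; rewrite integral0.
Qed.

Lemma test_function_sub (A B : set (R * R)) (phi : R * R -> R) :
  A `<=` B -> test_function A phi -> test_function B phi.
Proof. by move=> AB [sphi cphi Aphi]; split => //; exact: subset_trans AB. Qed.

Definition rectangle (a l L : R) : set (R * R) :=
  `]a, (a + l)[ `*` `](- (L / 2)), (L / 2)[.

(** Written as a linear combination with real coefficients, the shape handled by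
    [inner_combl]. *)
Definition minus_laplacian (phi : R * R -> R) : R * R -> R :=
  fun z => -1 * partial ord0 (partial ord0 phi) z +
           -1 * partial ord_max (partial ord_max phi) z.

(** In a product the Rayleigh quotients of the two factors add up. *)
Lemma rectangle_trial_exists (a l L eta : R) :
  0 < l -> 0 < L -> - (L / 2) <= a -> a + l <= L / 2 -> 0 < eta -> 8 * eta < 1 ->
  exists phi, [/\ test_function (rectangle a l L) phi,
    0 < inner (square L) phi phi &
    (1 - 8 * eta) * inner (square L) (minus_laplacian phi) phi <=
    ((pi / l) ^+ 2 + (pi / L) ^+ 2) * inner (square L) phi phi].
Proof.
move=> l0 L0 La alL eta0 eta8.
have [p [sp [e e0 pe] p0 pR]] := interval_trial_exists a l0 eta0 eta8.
have [q [sq [e' e'0 qe] q0 qR]] := interval_trial_exists (- (L / 2)) L0 eta0 eta8.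
have LL : - (L / 2) + L = L / 2 by lra.
rewrite LL in qe q0 qR.
have tphi : test_function (rectangle a l L) (tensor p q).
  by apply: tensor_test_function sp sq pe qe _ _ _ _; lra.
have sub : rectangle a l L `<=` square L.
  move=> z [/=]; rewrite !in_itv/= => /andP[x1 x2] z2.
  by split; rewrite /= in_itv/=//; apply/andP; split; lra.
have tphi' := test_function_sub sub tphi.
have [dp pdp sdp] := smooth_line_derive sp.
have [dq qdq sdq] := smooth_line_derive sq.
have [ddp dpddp sddp] := smooth_line_derive sdp.
have [ddq dqddq sddq] := smooth_line_derive sdq.
have n01 : (ord_max : 'I_2) != ord0 by [].
have E0 : partial ord0 (partial ord0 (tensor p q)) = tensor ddp q.
  by rewrite (partial_tensor0 q pdp) (partial_tensor0 q dpddp).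
have E1 : partial ord_max (partial ord_max (tensor p q)) = tensor p ddq.
  by rewrite (partial_tensor1 p n01 qdq) (partial_tensor1 p n01 dqddq).
have t0 := test_function_partial ord0 (test_function_partial ord0 tphi').
have t1 := test_function_partial ord_max (test_function_partial ord_max tphi').
rewrite E0 in t0; rewrite E1 in t1.
have L2phi := test_function_L2 tphi'.
have L20 := test_function_L2 t0.
have L21 := test_function_L2 t1.
have cp := smooth_line_continuous sp.
have cq := smooth_line_continuous sq.
have cdp := smooth_line_continuous sdp.
have cdq := smooth_line_continuous sdq.
have cddp := smooth_line_continuous sddp.
have cddq := smooth_line_continuous sddq.
have ps x : p x != 0 -> a < x < a + l.
  by move=> /pe /andP[x1 x2]; apply/andP; split; lra.
have qs y : q y != 0 -> - (L / 2) < y < L / 2.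
  by move=> /qe /andP[x1 x2]; apply/andP; split; lra.
have pa : p a = 0 by apply/eqP/negPn/negP => /ps; rewrite ltxx.
have pb : p (a + l) = 0 by apply/eqP/negPn/negP => /ps; rewrite ltxx andbF.
have qa : q (- (L / 2)) = 0 by apply/eqP/negPn/negP => /qs; rewrite ltxx.
have qb : q (L / 2) = 0 by apply/eqP/negPn/negP => /qs; rewrite ltxx andbF.
have al : a < a + l by rewrite ltrDl.
have LL' : - (L / 2) < L / 2 by lra.
pose P := \int[mu]_(x in `[a, a + l]) p x ^+ 2.
pose P' := \int[mu]_(x in `[a, a + l]) dp x ^+ 2.
pose Q := \int[mu]_(x in `[(- (L / 2)), L / 2]) q x ^+ 2.
pose Q' := \int[mu]_(x in `[(- (L / 2)), L / 2]) dq x ^+ 2.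
have N : inner (square L) (tensor p q) (tensor p q) = P * Q.
  rewrite (@inner_tensor R L a (a + l) (- (L / 2)) (L / 2))//.
have N0 : inner (square L) (tensor ddp q) (tensor p q) = - P' * Q.
  rewrite innerC (@inner_tensor R L a (a + l) (- (L / 2)) (L / 2))//.
  congr (_ * _); rewrite -(integral_by_parts_compact al pdp dpddp cddp pa pb).
  by apply: eq_Rintegral => x _; rewrite mulrC.
have N1 : inner (square L) (tensor p ddq) (tensor p q) = - P * Q'.
  rewrite innerC (@inner_tensor R L a (a + l) (- (L / 2)) (L / 2))//.
  rewrite mulNr -mulrN.
  congr (_ * _); rewrite -(integral_by_parts_compact LL' qdq dqddq cddq qa qb).
  by apply: eq_Rintegral => x _; rewrite mulrC.
exists (tensor p q); split => //; first by rewrite N mulr_gt0.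
have -> : inner (square L) (minus_laplacian (tensor p q)) (tensor p q) = P' * Q + P * Q'.
  by rewrite /minus_laplacian E0 E1 inner_combl// N0 N1; ring.
rewrite N.
have := ler_wpM2r (ltW q0) (pR dp pdp cdp); rewrite -/P -/P' -/Q => H1.
have := ler_wpM2l (ltW p0) (qR dq qdq cdq); rewrite -/Q -/Q' -/P => H2.
lra.
Qed.

(** As w vanishes on both supports, each trial function sees only the Laplacian,
    and disjoint supports remove the cross terms. *)
Lemma second_eigenvalue_upper_bound (L M r : R) w (lam : nat -> R) psi
    (A1 A2 : set (R * R)) (f1 f2 : R * R -> R) :
  measurable_fun setT w -> (forall z, 0 <= w z <= M) ->
  hilbert_basis (square L) psi -> {homo lam : j k / (j <= k)%N >-> j <= k} ->
  (forall k, schrodinger w L (psi k) (fun z => lam k * psi k z)) ->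
  A1 `<=` square L -> A2 `<=` square L -> (forall z, A1 z -> ~ A2 z) ->
  (forall z, A1 z \/ A2 z -> w z = 0) ->
  test_function A1 f1 -> test_function A2 f2 ->
  0 < inner (square L) f1 f1 -> 0 < inner (square L) f2 f2 ->
  inner (square L) (minus_laplacian f1) f1 <= r * inner (square L) f1 f1 ->
  inner (square L) (minus_laplacian f2) f2 <= r * inner (square L) f2 f2 ->
  lam 1%N <= r.
Proof.
move=> mw wM basis lam_le sch A1L A2L A12 wA tf1 tf2 f1n f2n f1r f2r.
have [Lpsi _ _] := basis.
have step A f : A `<=` square L -> (forall z, A z -> w z = 0) -> test_function A f ->
    [/\ L2 (square L) f, L2 (square L) (minus_laplacian f),
        forall z, ~ A z -> f z = 0 /\ minus_laplacian f z = 0 &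
        forall k, inner (square L) (minus_laplacian f) (psi k) = lam k * inner (square L) f (psi k)].
  move=> AL wA0 tf; have tf' := test_function_sub AL tf.
  have Lf := test_function_L2 tf'.
  have t0 := test_function_partial ord0 (test_function_partial ord0 tf).
  have t1 := test_function_partial ord_max (test_function_partial ord_max tf).
  have L0 := test_function_L2 (test_function_sub AL t0).
  have L1 := test_function_L2 (test_function_sub AL t1).
  split => //; first exact: L2_comb.
    move=> z nA; split; first exact: test_function_eq0 tf nA.
    by rewrite /minus_laplacian (test_function_eq0 t0 nA) (test_function_eq0 t1 nA) mulr0 addr0.
  move=> k.
  have wf : w \* f = fun=> 0.
    apply/funext => z /=; have [Az|nA] := pselect (A z); first by rewrite wA0 ?mul0r.
    by rewrite (test_function_eq0 tf nA) mulr0.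
  have wpf : inner (square L) (w \* psi k) f = 0.
    by rewrite inner_mulC wf inner_eq0// => z; rewrite mulr0.
  have W := schrodinger_weak mw wM (sch k) tf'.
  rewrite wpf addr0 in W.
  apply: etrans (inner_combl (-1) (-1) L0 L1 (Lpsi k)) _.
  have arith (a b c a' b' c' l : R) : a = a' -> b = b' -> c = c' ->
      l * c' = - (a' + b') -> -1 * a + -1 * b = l * c.
    by move=> -> -> -> ->; ring.
  exact: arith (innerC _ _ _) (innerC _ _ _) (innerC _ _ _) W.
have [Lf1 Lh1 z1 e1] := step A1 f1 A1L (fun z h => wA z (or_introl h)) tf1.
have [Lf2 Lh2 z2 e2] := step A2 f2 A2L (fun z h => wA z (or_intror h)) tf2.
have cross g1 g2 : (forall z, ~ A1 z -> g1 z = 0) -> (forall z, ~ A2 z -> g2 z = 0) ->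
    inner (square L) g1 g2 = 0.
  move=> h1 h2; apply: inner_eq0 => z.
  have [a1|n1] := pselect (A1 z); last by rewrite h1 ?mul0r.
  by rewrite h2 ?mulr0//; exact: A12.
have f12 : inner (square L) f1 f2 = 0.
  by apply: cross => z /= nz; [have [] := z1 z nz|have [] := z2 z nz].
have h12 : inner (square L) (minus_laplacian f1) f2 = 0.
  by apply: cross => z /= nz; [have [] := z1 z nz|have [] := z2 z nz].
have h21 : inner (square L) (minus_laplacian f2) f1 = 0.
  apply: etrans (innerC _ _ _) _.
  by apply: cross => z /= nz; [have [] := z1 z nz|have [] := z2 z nz].
exact: second_eigenvalue_le_rayleigh basis lam_le Lf1 Lf2 Lh1 Lh2 e1 e2 f12 h12 h21
  f1n f2n f1r f2r.
Qed.

End SecondEigenvalue.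

(** * The two eigenvalues in the large square *)

Section Gap.
Context {R : realType}.
Implicit Types (v w : plane R -> R).

Lemma Linfty_ae_bound v : Linfty_plane v ->
  measurable_fun setT v /\ exists M : R, {ae lebesgue2, forall z, `|v z| <= M}.
Proof.
move=> /andP[]; rewrite !inE/= /finite_norm unlock => mv.
case: ifPn => [mu0|]; last first.
  rewrite -leNgt => mu0 _; split => //; exists 0.
  exists setT; split => //.
  by apply/eqP; rewrite eq_le mu0 measure_ge0.
move=> fin; split => //.
have [M HM] : exists M : R, (ess_sup lebesgue2 (abse \o (EFin \o v)) <= M%:E)%E.
  move: fin; case: (ess_sup _ _) => [r _|//|_]; first by exists r.
  by exists 0; rewrite leNye.
exists M; move/ess_supP: HM.
by apply: filterS => z /=; rewrite lee_fin.
Qed.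

(** Only the class of the potential modulo null sets matters, so an essentially
    bounded potential may be replaced by a bounded one. *)
Lemma eigenvalues_ae v w (L : R) lam :
  {ae lebesgue2, forall z, v z = w z} -> eigenvalues v L lam -> eigenvalues w L lam.
Proof.
move=> vw [lam_le lamoo [psi basis sch]]; split => //; exists psi => // k.
have [h10 h2 [d dP ae]] := sch k; split => //; exists d => //.
apply: filterS2 vw ae => z -> H; exact: H.
Qed.

Lemma first_eigenvalue_ge (L delta gamma theta M : R) w (lam : nat -> R) :
  let k := 2 * pi * theta / L in
  let tau := k * tan (pi * theta / 2) in
  0 < L -> 0 < theta < 1 -> 0 < delta -> delta < L / 2 -> 0 <= gamma ->
  tau / delta + tau ^+ 2 <= gamma - k ^+ 2 ->
  measurable_fun setT w -> (forall z, 0 <= w z <= M) ->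
  (forall x y, - delta < x < delta -> gamma <= w (x, y)) ->
  eigenvalues w L lam ->
  k ^+ 2 + (pi * theta / L) ^+ 2 <= lam 0%N.
Proof.
move=> k tau L0 tt d0 dL g0 taug mw wM wg [_ _ [psi [_ orth _] sch]].
apply: (eigenvalue_lower_bound mw wM (sch 0%N)); first by rewrite orth eqxx.
move=> phi tphi.
have ex := energy_x_lower_bound L0 tt d0 dL g0 taug mw wM wg tphi.
have ey := energy_y_lower_bound L0 tt tphi.
rewrite mulrDl addrAC; exact: lerD ex ey.
Qed.

Lemma second_eigenvalue_le (L delta eta M : R) w (lam : nat -> R) :
  0 < delta -> delta < L / 2 -> 0 < eta -> 8 * eta < 1 ->
  measurable_fun setT w -> (forall z, 0 <= w z <= M) ->
  (forall x y : R, ~~ (- delta < x < delta) -> w (x, y) = 0) ->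
  eigenvalues w L lam ->
  lam 1%N <= ((pi / (L / 2 - delta)) ^+ 2 + (pi / L) ^+ 2) / (1 - 8 * eta).
Proof.
move=> d0 dL eta0 eta8 mw wM w0 [lam_le _ [psi basis sch]].
have L0 : 0 < L by lra.
pose l := L / 2 - delta.
have l0 : 0 < l by rewrite subr_gt0.
have [f1 [tf1 n1 r1]] := @rectangle_trial_exists R (- (L / 2)) l L eta l0 L0 ltac:(lra)
  ltac:(rewrite /l; lra) eta0 eta8.
have [f2 [tf2 n2 r2]] := @rectangle_trial_exists R delta l L eta l0 L0 ltac:(lra)
  ltac:(rewrite /l; lra) eta0 eta8.
have e8 : 0 < 1 - 8 * eta by lra.
have mv (A B C : R) : (1 - 8 * eta) * A <= B * C -> A <= B / (1 - 8 * eta) * C.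
  move=> h; rewrite mulrAC ler_pdivlMr// mulrC; exact: h.
apply: (second_eigenvalue_upper_bound mw wM basis lam_le sch _ _ _ _ tf1 tf2 n1 n2
  (mv _ _ _ r1) (mv _ _ _ r2)).
- move=> z [/=]; rewrite !in_itv/= => /andP[x1 x2] z2.
  by split; rewrite /= in_itv/=//; apply/andP; split; rewrite /l in x2; lra.
- move=> z [/=]; rewrite !in_itv/= => /andP[x1 x2] z2.
  by split; rewrite /= in_itv/=//; apply/andP; split; rewrite /l in x2; lra.
- move=> z [/=]; rewrite !in_itv/= => /andP[x1 x2] _ [/=].
  by rewrite !in_itv/= => /andP[y1 _] _; rewrite /l in x2; lra.
- case=> x y [[/=]|[/=]]; rewrite !in_itv/= => /andP[x1 x2] _; apply: w0.
    by apply/negP => /andP[h1 h2]; rewrite /l in x2; lra.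
  by apply/negP => /andP[h1 h2]; lra.
Qed.

(** With theta = 1 - t one has theta^-3 - theta^2 = (1 - theta^5) / theta^3, which
    is at most 40 t when t <= 1/2; so 5 pi^2 * 40 t <= e / 2 for
    t <= e / (20 pi)^2. *)
Lemma theta_of_epsilon (theta e : R) : 0 < e ->
  theta = 1 - Num.min 2^-1 (e / ((20 * pi) ^+ 2)) ->
  0 < theta < 1 /\ 5 * pi ^+ 2 / theta ^+ 3 - 5 * pi ^+ 2 * theta ^+ 2 < e.
Proof.
move=> e0 ->; set t := Num.min _ _.
have pi0 : 0 < pi :> R := pi_gt0 R.
have p2 : 0 < (20 * pi) ^+ 2 :> R by rewrite exprn_gt0// mulr_gt0// ltr0n.
have t0 : 0 < t by rewrite lt_min invr_gt0 ltr0n/= divr_gt0.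
have t1 : t <= 2^-1 by rewrite ge_min lexx.
have te : t <= e / ((20 * pi) ^+ 2) by rewrite ge_min lexx orbT.
rewrite ler_pdivlMr// in te.
split; first by apply/andP; split; lra.
set th := 1 - t.
have th2 : 2^-1 <= th by rewrite /th; lra.
have th1 : th <= 1 by rewrite /th; lra.
have th0 : 0 < th by lra.
have c3 : 8^-1 <= th ^+ 3.
  have -> : 8^-1 = 2^-1 ^+ 3 :> R by field.
  by rewrite ler_pXn2r// nnegrE; lra.
have c0 : 0 < th ^+ 3 by rewrite exprn_gt0.
have five : 1 - th ^+ 5 <= 5 * t.
  have -> : t = 1 - th by rewrite /th; lra.
  have -> : 1 - th ^+ 5 = (1 - th) * (1 + th + th ^+ 2 + th ^+ 3 + th ^+ 4) by ring.
  rewrite mulrC ler_wpM2r ?subr_ge0//.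
  have h n : th ^+ n <= 1 by rewrite exprn_ile1// ltW.
  have := h 2%N; have := h 3%N; have := h 4%N; lra.
have -> : 5 * pi ^+ 2 / th ^+ 3 - 5 * pi ^+ 2 * th ^+ 2 =
  5 * pi ^+ 2 * (1 - th ^+ 5) / th ^+ 3 by field; lra.
rewrite ltr_pdivrMr//.
have q := ler_wpM2l (ltW e0) c3.
have p5 : 0 <= 5 * pi ^+ 2 :> R by rewrite mulr_ge0// sqr_ge0.
have := ler_wpM2l p5 five.
have -> : 5 * pi ^+ 2 * (5 * t) = (t * ((20 * pi) ^+ 2)) / 16 by field.
lra.
Qed.

(** The Riccati inequality inside the strip, for tau = k T, reduced to a condition
    that is linear in k. *)
Lemma strip_condition (k T delta gamma : R) : 0 <= k <= 1 ->
  k * (T / delta + T ^+ 2 + 1) <= gamma ->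
  k * T / delta + (k * T) ^+ 2 <= gamma - k ^+ 2.
Proof.
move=> /andP[k0 k1] kg.
have kk : k ^+ 2 * (T ^+ 2 + 1) <= k * (T ^+ 2 + 1).
  by rewrite ler_wpM2r ?addr_ge0 ?sqr_ge0// expr2 ler_piMr.
have -> : k * T / delta + (k * T) ^+ 2 = k * (T / delta) + k ^+ 2 * T ^+ 2 by ring.
lra.
Qed.

(** Both L/2 - delta and L are bounded below by multiples of theta L, which puts
    the two bounds in the same form. *)
Lemma scaled_gap_le (p theta L delta l0 l1 : R) :
  0 < p -> 0 < theta -> theta < 1 -> 0 < L -> 0 < delta ->
  2 * delta <= (1 - theta) * L ->
  (2 * p * theta / L) ^+ 2 + (p * theta / L) ^+ 2 <= l0 ->
  l1 <= ((p / (L / 2 - delta)) ^+ 2 + (p / L) ^+ 2) / theta ->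
  L ^+ 2 * (l1 - l0) <= 5 * p ^+ 2 / theta ^+ 3 - 5 * p ^+ 2 * theta ^+ 2.
Proof.
move=> p0 t0 t1 L0 d0 Ld low up.
have lw : L / 2 * theta <= L / 2 - delta by lra.
have h0 : 0 < L / 2 * theta by rewrite !mulr_gt0// invr_gt0.
have h1 : 0 < L * theta by rewrite mulr_gt0.
have inv (a b : R) : 0 < a -> a <= b -> (p / b) ^+ 2 <= (p / a) ^+ 2.
  move=> a0 ab; have b0 := lt_le_trans a0 ab.
  rewrite ler_pXn2r// ?nnegrE ?divr_ge0 ?(ltW p0) ?(ltW a0) ?(ltW b0)//.
  by rewrite ler_pM2l// lef_pV2// posrE.
have p1 := inv _ _ h0 lw.
have p2 : (p / L) ^+ 2 <= (p / (L * theta)) ^+ 2.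
  by apply: inv => //; rewrite ler_piMr ?ltW.
have up' : l1 <= ((p / (L / 2 * theta)) ^+ 2 + (p / (L * theta)) ^+ 2) / theta.
  by apply: (le_trans up); rewrite ler_wpM2r ?invr_ge0 ?(ltW t0)// lerD.
have -> : 5 * p ^+ 2 / theta ^+ 3 - 5 * p ^+ 2 * theta ^+ 2 =
    L ^+ 2 * (((p / (L / 2 * theta)) ^+ 2 + (p / (L * theta)) ^+ 2) / theta -
              ((2 * p * theta / L) ^+ 2 + (p * theta / L) ^+ 2)).
  by field; rewrite !gt_eqF.
by rewrite ler_wpM2l ?sqr_ge0// lerB.
Qed.

End Gap.

(** The three lower bounds on L say that the strip is thin compared with the
    square, that k <= 1, and that the Riccati inequality holds in the strip. *)
Lemma scaled_gap_bound (R : realType) (L delta gamma theta M : R) (w : plane R -> R)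
    (lam : nat -> R) :
  let T := tan (pi * theta / 2) in
  let k := 2 * pi * theta / L in
  0 < gamma -> 0 < delta -> 0 < theta < 1 -> 0 < L -> 2 * delta <= (1 - theta) * L ->
  2 * pi * theta <= L -> 2 * pi * theta * (T / delta + T ^+ 2 + 1) <= gamma * L ->
  measurable_fun setT w -> (forall z, 0 <= w z <= M) ->
  (forall x y, - delta < x < delta -> gamma <= w (x, y)) ->
  (forall x y : R, ~~ (- delta < x < delta) -> w (x, y) = 0) ->
  eigenvalues w L lam ->
  L ^+ 2 * spectral_gap lam <= 5 * pi ^+ 2 / theta ^+ 3 - 5 * pi ^+ 2 * theta ^+ 2.
Proof.
move=> T k g0 d0 tt L0 Ld Lk Lg mw wM wg w0 eig.
have /andP[t0 t1] := tt.
have pi0 : 0 < pi :> R := pi_gt0 R.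
have Lth : theta * L < L by rewrite gtr_pMl.
have dL : delta < L / 2.
  by have := mulr_gt0 t0 L0; move: Ld Lth; rewrite mulrBl mul1r; clear; lra.
have k0 : 0 < k by rewrite /k divr_gt0// !mulr_gt0.
have k1 : k <= 1 by rewrite /k ler_pdivrMr// mul1r.
have low : k ^+ 2 + (pi * theta / L) ^+ 2 <= lam 0%N.
  apply: (first_eigenvalue_ge L0 tt d0 dL (ltW g0) _ mw wM wg eig).
  by apply: strip_condition; rewrite ?(ltW k0) ?k1// -/k /k mulrAC ler_pdivrMr.
have up : lam 1%N <= ((pi / (L / 2 - delta)) ^+ 2 + (pi / L) ^+ 2) / theta.
  have := @second_eigenvalue_le R L delta ((1 - theta) / 8) M w lam d0 dL.
  have -> : 1 - 8 * ((1 - theta) / 8) = theta by field.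
  apply => //.
  - by move: t1; clear; lra.
  - by move: t0; clear; lra.
exact: (scaled_gap_le pi0 t0 t1 L0 d0 Ld low up).
Qed.

Theorem theorem8 (R : realType) (gamma delta : R) (v : plane R -> R)
    (lam : R -> nat -> R) :
  0 < gamma -> 0 < delta ->
  Linfty_plane v ->
  (forall z, 0 <= v z) ->
  (forall x y : R, - delta < x < delta -> gamma <= v (x, y)) ->
  (forall x y : R, ~~ (- delta < x < delta) -> v (x, y) = 0) ->
  (forall L : R, 0 < L -> eigenvalues v L (lam L)) ->
  L ^+ 2 * spectral_gap (lam L) @[L --> +oo] --> (0 : R).
Proof.
move=> g0 d0 vinf v0 vg vz eig.
have pi0 : 0 < pi :> R := pi_gt0 R.
have [mv [N vN]] := Linfty_ae_bound vinf.
pose M := Num.max N gamma.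
have M0 : 0 <= M by rewrite le_max (ltW g0) orbT.
(* a bounded representative of v, still at least gamma on the strip *)
pose w z := Num.min (v z) M.
have mw : measurable_fun setT w by apply: measurable_minr.
have wM z : 0 <= w z <= M by rewrite le_min v0 M0 ge_min lexx orbT.
have wg x y : - delta < x < delta -> gamma <= w (x, y).
  by move=> xd; rewrite le_min vg// le_max lexx orbT.
have w0 x y : ~~ (- delta < x < delta) -> w (x, y) = 0.
  by move=> xd; rewrite /w vz//; apply/min_idPl.
have vw : {ae lebesgue2, forall z, v z = w z}.
  apply: filterS vN => z vzN; apply/esym/min_idPl.
  by rewrite le_max (le_trans (ler_norm _) vzN).
apply/cvgr0Pnorm_lt => e e0.
(* theta is fixed from e before L is taken large *)
have [tt small] := theta_of_epsilon e0 erefl.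
set theta : R := 1 - _ in tt small.
have /andP[t0 t1] := tt.
pose T := tan (pi * theta / 2) : R.
near=> L.
have L0 : 0 < L by near: L; exact: nbhs_pinfty_gt.
have eigL := eigenvalues_ae vw (eig L L0).
have [lam_le _ _] := eigL.
rewrite ger0_norm; last by rewrite mulr_ge0 ?sqr_ge0// subr_ge0; exact: lam_le.
apply: le_lt_trans small.
apply: (@scaled_gap_bound R L delta gamma theta M w) => //.
- by rewrite [leRHS]mulrC -ler_pdivrMr ?subr_gt0//; near: L.
- by rewrite [leRHS]mulrC -ler_pdivrMr//; near: L.
Unshelve. all: by end_near. Qed.
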